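(* Let $n\ge1$ and $\Delta_n=\{\lambda\in\mathbb R^n:1\ge\lambda_1\ge\dots\ge\lambda_n\ge-1\}$. For $s\in\mathbb C$ with $\mathrm{Re}(s)>-1$, $$\int_{\Delta_n}\prod_{i=1}^n|\lambda_i|^s\prod_{i<j}(\lambda_i-\lambda_j)\,d\lambda=2^n\,\frac{\displaystyle\prod_{1\le i<j\le n,\ i\equiv j\,(\mathrm{mod}\,2)}(j-i)}{\displaystyle\prod_{1\le i\le n,\ i\equiv1\,(\mathrm{mod}\,2)}(s+i)\ \prod_{1\le i<j\le n,\ i\not\equiv j\,(\mathrm{mod}\,2)}(2s+i+j)}.$$ *)

(* Defs.v *)
From HB Require Import structures.
From mathcomp Require Import all_boot all_order all_algebra.
From mathcomp Require Import all_classical all_reals all_analysis.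
From mathcomp Require Import complex.
Set Implicit Arguments.
Unset Strict Implicit.
Unset Printing Implicit Defensive.
Import Order.TTheory GRing.Theory Num.Theory.
Import numFieldNormedType.Exports.

Local Open Scope classical_set_scope.
Local Open Scope ring_scope.

(* R^n, with the product sigma-algebra generated by the coordinates. *)
Notation Rn R n := (n.-tuple (measurableTypeR R)).

Section lebesgue_measure_Rn.
Local Open Scope ereal_scope.
Context {R : realType}.

Definition consRn n (p : measurableTypeR R * Rn R n) : Rn R n.+1 :=
  [tuple of p.1 :: p.2].

Definition unconsRn n (t : Rn R n.+1) : measurableTypeR R * Rn R n :=
  (thead t, [tuple of behead t]).

Lemma consRnK n : cancel (@consRn n) (@unconsRn n).
Proof. by move=> [x t]; rewrite /unconsRn; congr pair; exact: val_inj. Qed.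

Lemma measurable_consRn n : measurable_fun setT (@consRn n).
Proof. exact: measurable_cons. Qed.

Lemma measurable_unconsRn n : measurable_fun setT (@unconsRn n).
Proof.
apply/measurable_fun_pair; last exact: measurable_behead.
exact: (measurable_tnth (ord0 : 'I_n.+1)).
Qed.

Section step.
Variables (n : nat) (m : {sigma_finite_measure set (Rn R n) -> \bar R}).

Let prod : {measure set (measurableTypeR R * Rn R n)%type -> \bar R} :=
  lebesgue_measure \x m.

Definition lebesgue_cons : set (Rn R n.+1) -> \bar R :=
  pushforward (lebesgue_measure \x m) (@consRn n).

Let mpre (A : set (Rn R n.+1)) : measurable A -> measurable (@consRn n @^-1` A).
Proof.
by move=> mA; rewrite -[X in measurable X]setTI; exact: measurable_consRn.
Qed.

Let lebesgue_cons0 : lebesgue_cons set0 = 0.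
Proof. by rewrite /lebesgue_cons /pushforward preimage_set0 measure0. Qed.

Let lebesgue_cons_ge0 A : 0 <= lebesgue_cons A.
Proof. exact: (measure_ge0 prod). Qed.

Let lebesgue_cons_sigma_additive : semi_sigma_additive lebesgue_cons.
Proof.
move=> F mF tF mUF; rewrite /lebesgue_cons /pushforward preimage_bigcup.
apply: (measure_semi_sigma_additive (s := prod)) => [k| |].
- exact: mpre.
- apply/trivIsetP => i j _ _ ij; rewrite -preimage_setI.
  by move/trivIsetP : tF => /(_ _ _ _ _ ij) ->//; rewrite preimage_set0.
- by rewrite -preimage_bigcup; exact: mpre.
Qed.

HB.instance Definition _ := isMeasure.Build _ _ _ lebesgue_cons
  lebesgue_cons0 lebesgue_cons_ge0 lebesgue_cons_sigma_additive.

Let lebesgue_cons_sigma_finite : sigma_finite setT lebesgue_cons.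
Proof.
have /sigma_finiteP[F [FT ndF Foo]] := sigma_finiteT (@lebesgue_measure R).
have /sigma_finiteP[G [GT ndG Goo]] := sigma_finiteT m.
exists (fun k => @unconsRn n @^-1` (F k `*` G k)).
  rewrite -preimage_bigcup -(@preimage_setT _ _ (@unconsRn n)).
  congr (_ @^-1` _); apply/esym; rewrite -subTset => -[x t] _.
  have [i _ Fx] : (\bigcup_k F k) x by rewrite -FT.
  have [j _ Gt] : (\bigcup_k G k) t by rewrite -GT.
  exists (maxn i j) => //; split => /=.
    by move: x Fx; exact/subsetPset/ndF/leq_maxl.
  by move: t Gt; exact/subsetPset/ndG/leq_maxr.
move=> k; have [mF Fk] := Foo k; have [mG Gk] := Goo k; split.
  rewrite -[X in measurable X]setTI.
  by apply: measurable_unconsRn => //; exact: measurableX.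
rewrite /lebesgue_cons /pushforward -comp_preimage.
rewrite (_ : _ \o _ = id); last by apply/funext => p /=; rewrite consRnK.
by rewrite preimage_id product_measure1E// lte_mul_pinfty// ge0_fin_numE.
Qed.

HB.instance Definition _ := Measure_isSigmaFinite.Build _ _ _ lebesgue_cons
  lebesgue_cons_sigma_finite.

End step.

(* R^0 is a point of mass 1, and the Lebesgue measure on R^(n+1) is the product
   of those on R and R^n, transported along (x, t) |-> x :: t. *)
Fixpoint lebesgue_measure_Rn n :
    {sigma_finite_measure set (Rn R n) -> \bar R} :=
  if n is k.+1 then lebesgue_cons (lebesgue_measure_Rn k)
  else \d_([tuple] : Rn R 0).

End lebesgue_measure_Rn.

Section complex_valued.
Context {R : realType}.

(* Re and Im are qualified because 'Re and 'Im of ssrnum are R[i]-valued. *)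
Definition cexp (z : R[i]) : R[i] :=
  Complex (expR (complex.Re z) * cos (complex.Im z))
          (expR (complex.Re z) * sin (complex.Im z)).

(* x ^ s for a real x >= 0; 0 ^ s follows the convention of powR. *)
Definition cpowR (x : R) (s : R[i]) : R[i] :=
  if x == 0 then (s == 0)%:R else cexp (s * (ln x)%:C%C).

Context {d : measure_display} {T : measurableType d}.
Variables (mu : {measure set T -> \bar R}) (D : set T) (f : T -> R[i]).

Definition cintegrable : Prop :=
  mu.-integrable D (fun x => (complex.Re (f x))%:E) /\
  mu.-integrable D (fun x => (complex.Im (f x))%:E).

(* Meaningful only under cintegrable: Rintegral is total. *)
Definition cintegral : R[i] :=
  Complex (\int[mu]_(x in D) complex.Re (f x))
          (\int[mu]_(x in D) complex.Im (f x)).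

End complex_valued.

(* The chain 1 >= l_1 >= ... >= l_n >= -1. *)
Definition Delta (R : realType) (n : nat) : set (Rn R n) :=
  [set l : Rn R n | path >=%R (1 : R) (rcons l (- 1 : R))].

(* Main.v *)
Require Import Defs.
From HB Require Import structures.
From mathcomp Require Import all_boot all_order all_fingroup all_algebra.
From mathcomp Require Import all_classical all_reals all_analysis.
From mathcomp Require Import measurable_realfun complex ring lra zify.
Import Order.TTheory GRing.Theory Num.Theory.
Import numFieldNormedType.Exports.

(** The product of the differences is a Vandermonde determinant. Expanding it
    over permutations turns the integral into an alternating sum of chain
    integrals J(c_0, ..., c_(n-1)): a letter c = (b, e) stands for the function
    sg(t)^e |t|^(b-1) on [-1, 1], J integrates the product of the letters over
    -1 <= x_0 <= ... <= x_(n-1) <= 1, and the letter of the monomial t^k is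
    (s + k + 1, parity of k).

    A chain integral is elementary. If exactly the first k variables are
    negative, it splits at 0 into two integrals over simplices with a corner at
    0, each of them, up to sign, a product of inverses of partial sums of the b_i
    ([neg_coef], [pos_coef]); J is the sum over k ([chain]). Enlarging the
    simplex by a dilation, or cancelling denominators in this formula, gives
    ([chain_rec])
      (b_0 + ... + b_(n-1)) J(c_0, ..., c_(n-1))
        = J(c_0, ..., c_(n-2)) + (-1)^(e_0) J(c_1, ..., c_(n-1)),
    where the two terms are the contributions of the faces x_(n-1) = 1 and
    x_0 = -1.

    In the sum over permutations every letter can be removed at either end,
    with signs that cancel unless the parity of the letter is opposite to that
    of n ([altchain_rec]). So the alternating sum A(c) satisfies a recursion that
    removes only odd letters when n is even and only even letters when n is odd.
    It determines A(c), and the product formula of [closed_form] satisfies it: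
    after division by the closed form, the recursion is the identity
      sum_i prod_y (x_i - y) / prod_(j <> i) (x_i - x_j) = sum_i x_i - sum_y y
    for as many y as x, where the x_i are the b of the removable letters and the
    y are the -b of the others, together with 0 when n is odd
    ([sum_lagrange], [sum_closed_form_lift], [altchain_closed_form]).

    The analytic part identifies J with the integral. By Fubini
    ([cintegral_consRn]) the largest variable is integrated last, so by induction
    it is enough to integrate one letter against the function of the upper bound
    x obtained for n - 1 variables, which is a combination of signed powers of x
    ([cintegral_step]). Integrability comes from the bound |t|^(Re s) in each
    variable. Since Re s may be negative, the one-variable integral uses a form
    of the fundamental theorem of calculus in which the integrand may be
    unbounded at an endpoint ([integrable_FTC2]). *)

Set Implicit Arguments.
Unset Strict Implicit.
Unset Printing Implicit Defensive.

Local Open Scope classical_set_scope.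
Local Open Scope ring_scope.

(** * Interpolation, permutations and products over pairs *)

(** With f = prod_y (X - y) and h = prod_i (X - x_i), the polynomial f - h has
    degree < #|P|, so it is its own Lagrange interpolant at the x_i; compare the
    coefficients of degree #|P| - 1. *)
Lemma sum_lagrange (F : fieldType) (I : finType) (P : pred I) (x : I -> F)
    (ys : seq F) :
  {in P &, injective x} -> size ys = #|P| -> (0 < #|P|)%N ->
  \sum_(i | P i)
     (\prod_(y <- ys) (x i - y)) / \prod_(j | P j && (j != i)) (x i - x j) =
  \sum_(i | P i) x i - \sum_(y <- ys) y.
Proof.
move=> injx szys P_gt0.
pose xs := [seq x i | i <- enum P].
pose f : {poly F} := \prod_(y <- ys) ('X - y%:P).
pose h : {poly F} := \prod_(y <- xs) ('X - y%:P).
pose D i := \prod_(j | P j && (j != i)) (x i - x j).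
pose l i : {poly F} := \prod_(j | P j && (j != i)) ('X - (x j)%:P).
pose L : {poly F} := \sum_(i | P i) (f.[x i] / D i) *: l i.
have szxs : size xs = #|P| by rewrite size_map -cardE.
have szf : size f = #|P|.+1 by rewrite size_prod_XsubC szys.
have szh : size h = #|P|.+1 by rewrite size_prod_XsubC szxs.
have D0 i : P i -> D i != 0.
  move=> Pi; apply/prodf_neq0 => j /andP[Pj ji]; rewrite subr_eq0.
  by apply: contra ji => /eqP xij; apply/eqP/injx.
have szl i : P i -> size (l i) = #|P|.
  move=> Pi; rewrite /l -big_filter size_prod_XsubC.
  rewrite (cardD1 i P) -[i \in P]/(P i) Pi /= add1n; congr _.+1.
  rewrite cardE /enum_mem; congr size; apply: eq_filter => j /=.
  by rewrite !inE andbC.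
have szL : (size L <= #|P|)%N.
  apply: (leq_trans (size_sum _ _ _)); apply/bigmax_leqP => i Pi.
  by apply: (leq_trans (size_scale_leq _ _)); rewrite szl.
have szfh : (size (f - h)%R <= #|P|)%N.
  apply/leq_sizeP => j; rewrite leq_eqVlt => /predU1P[<-|ltj].
    rewrite coefB.
    have -> : f`_(#|P|) = lead_coef f by rewrite lead_coefE szf.
    have -> : h`_(#|P|) = lead_coef h by rewrite lead_coefE szh.
    rewrite (monicP (monic_prod_XsubC _ _ _)).
    by rewrite (monicP (monic_prod_XsubC _ _ _)) subrr.
  by rewrite coefB !nth_default ?subrr// ?szf ?szh.
have xsP i : P i -> x i \in xs.
  by move=> Pi; apply/mapP; exists i; rewrite // mem_enum.
have Lx i : P i -> L.[x i] = f.[x i].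
  move=> Pi; rewrite /L horner_sum (bigD1 i)//= big1 ?addr0 => [|j /andP[Pj ji]].
    rewrite hornerZ [X in _ * X]horner_prod (eq_bigr (fun j => x i - x j)) => [|j _].
      by rewrite divfK// D0.
    by rewrite hornerXsubC.
  rewrite hornerZ [X in _ * X]horner_prod (bigD1 i) /=; last by rewrite Pi eq_sym.
  by rewrite hornerXsubC subrr mul0r mulr0.
have fhL : f - h - L = 0.
  apply: (@roots_geq_poly_eq0 _ _ xs).
  - apply/allP => z /mapP[k]; rewrite mem_enum => Pi {z}->; apply/rootP.
    rewrite !hornerD !hornerN Lx// addrAC subrr sub0r; apply/eqP; rewrite oppr_eq0.
    by apply/eqP/rootP; rewrite root_prod_XsubC xsP.
  - rewrite map_inj_in_uniq ?enum_uniq// => i j; rewrite !mem_enum.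
    exact: injx.
  - rewrite szxs; apply: (leq_trans (size_polyD _ _)).
    by rewrite geq_max szfh size_polyN.
have : (f - h - L)`_(#|P|.-1) = 0 by rewrite fhL coef0.
rewrite !coefB -{1}szys -{1}szxs !coefPn_prod_XsubC ?szys ?szxs -?lt0n// opprK.
rewrite big_map big_enum /= => /eqP; rewrite subr_eq0 addrC => /eqP ->.
rewrite coef_sum; apply: eq_bigr => i Pi.
rewrite coefZ -(szl _ Pi) -lead_coefE (monicP (monic_prod_XsubC _ _ _)) mulr1.
by rewrite horner_prod; congr (_ / _); apply: eq_bigr => y _; rewrite hornerXsubC.
Qed.

(** Grouping the permutations by their value at i0. This plays, for alternating
    sums that are not determinants, the role of the expansion along a row. *)
Lemma sum_perm_lift (V : nmodType) n (i0 : 'I_n.+1) (f : 'S_n.+1 -> V) :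
  \sum_s f s = \sum_i \sum_(s : 'S_n) f (lift_perm i0 i s).
Proof.
rewrite (partition_big (fun s : 'S_n.+1 => s i0) predT)//=.
apply: eq_bigr => i _; rewrite (reindex (lift_perm i0 i)) /=.
  by apply: eq_bigl => s; rewrite lift_perm_id eqxx.
pose g (s : 'S_n.+1) k := odflt k (unlift (s i0) (s (lift i0 k))).
have gK (s : 'S_n.+1) k : lift (s i0) (g s k) = s (lift i0 k).
  rewrite /g; case: unliftP => [j ->//|].
  by move/perm_inj/eqP; rewrite eq_sym (negPf (neq_lift _ _)).
have g_inj s : injective (g s).
  move=> k1 k2 eqg; have := gK s k1; rewrite eqg gK => /perm_inj.
  by move/lift_inj.
exists (fun s => perm (g_inj s)) => [s _|s /eqP si].
  by apply/permP=> k; rewrite permE /g lift_perm_lift lift_perm_id liftK.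
apply/permP => k; case: (unliftP i0 k) => [k'|] ->; last by rewrite lift_perm_id.
by rewrite lift_perm_lift permE -si gK.
Qed.

Lemma card_ord_lt n (i : 'I_n) : #|[pred k : 'I_n | (k < i)%N]| = i.
Proof.
rewrite -sum1_card (eq_bigl (fun k : 'I_n => (k < i)%N)) //.
by rewrite (big_ord_narrow (ltnW (ltn_ord i))) sum1_card card_ord.
Qed.

(** Pulling the index i to the front reverses the i pairs (j, i) with j < i. *)
Lemma prod_pairs_lift (F : comNzRingType) n (Q : 'I_n.+1 -> 'I_n.+1 -> F) (i : 'I_n.+1) :
  (forall j k, j != k -> Q k j = - Q j k) ->
  \prod_(j < n.+1) \prod_(k < n.+1 | (j < k)%N) Q j k =
  (-1) ^+ i * (\prod_(j | j != i) Q i j) *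
  \prod_(j < n) \prod_(k < n | (j < k)%N) Q (lift i j) (lift i k).
Proof.
move=> Qanti; rewrite (bigD1_ord i)//=.
have -> : \prod_(j < n) \prod_(k < _ | (lift i j < k)%N) Q (lift i j) k =
   (\prod_(j < n) if (lift i j < i)%N then Q (lift i j) i else 1) *
   \prod_(j < n) \prod_(k < _ | (j < k)%N) Q (lift i j) (lift i k).
  rewrite -big_split /=; apply: eq_bigr => j _.
  have ltl k : (lift i j < lift i k)%N = (j < k)%N.
    by rewrite !ltnNge leq_bump2.
  case: ifP => ji.
    by rewrite (bigD1_ord i) //=; congr (_ * _); apply: eq_bigl => k; exact: ltl.
  rewrite mul1r big_mkcond (bigD1_ord i)//= ji mul1r -big_mkcond.
  by apply: eq_bigl => k; exact: ltl.
rewrite mulrA; congr (_ * _).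
have := @bigD1_ord _ *%R 1 _ i xpredT (fun k => if (k < i)%N then Q k i else 1) isT.
rewrite /= ltnn mul1r => <-; rewrite -big_mkcond /=.
rewrite [X in _ * X](eq_bigr (fun k => - Q i k)) => [|k ki]; last first.
  by apply: Qanti; rewrite -val_eqE/= gtn_eqF.
rewrite prodrN card_ord_lt [in RHS](bigID (fun k : 'I__ => (k < i)%N)) /=.
rewrite mulrCA; congr (_ * _); rewrite mulrC; congr (_ * _); apply: eq_bigl => k.
  by rewrite -[LHS]/(k < i)%N -val_eqE/=; case: (ltngtP (val k) (val i)).
by rewrite -val_eqE/=; case: (ltngtP (val k) (val i)).
Qed.

(** * Iterated integrals of signed powers: the algebra *)

Section chain_coefficients.
Context {F : fieldType}.
Implicit Types (w b : nat -> F) (i k n : nat).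

Definition psum b i k := \sum_(i <= m < k) b m.
(** The integrals of the product of the |x_m|^(b m - 1) over
    -1 <= x_i <= ... <= x_(k-1) <= 0 and over 0 <= x_k <= ... <= x_(n-1) <= 1. *)
Definition neg_coef b i k := \prod_(i <= j < k) (psum b j k)^-1.
Definition pos_coef b k n := \prod_(k <= j < n) (psum b k j.+1)^-1.
(** The sum over the index k of the first positive variable; w k is the sign due
    to the negative ones. *)
Definition cut_sum w b i n := \sum_(i <= k < n.+1) w k * neg_coef b i k * pos_coef b k n.

Lemma psum_cat b k i n : (i <= k <= n)%N -> psum b i k + psum b k n = psum b i n.
Proof. by move=> /andP[ik kn]; rewrite /psum -big_cat_nat. Qed.

Lemma psum0 b i : psum b i i = 0.
Proof. by rewrite /psum big_geq. Qed.

(** The total exponent is psum b i k + psum b k n.+1. The first summand cancels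
    the outermost denominator of neg_coef, which drops the variable i; the second
    one does the same for pos_coef and drops the variable n. *)
Lemma cut_sum_rec w b i n : (forall j k, (j < k)%N -> psum b j k != 0) ->
  (i <= n)%N ->
  psum b i n.+1 * cut_sum w b i n.+1 = cut_sum w b i n + cut_sum w b i.+1 n.+1.
Proof.
move=> nz le_in.
transitivity (\sum_(i <= k < n.+2) (psum b k n.+1 * (w k * neg_coef b i k * pos_coef b k n.+1)
   + psum b i k * (w k * neg_coef b i k * pos_coef b k n.+1))).
  rewrite mulr_sumr; apply: eq_big_nat => k /andP[ik kn].
  by rewrite -mulrDl; congr (_ * _); rewrite addrC psum_cat// ik -ltnS.
rewrite big_split /=; congr (_ + _).
  rewrite big_nat_recr /=; last by rewrite (leq_trans le_in).
  rewrite psum0 mul0r addr0.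
  apply: eq_big_nat => k /andP[ik kn].
  rewrite mulrCA; congr (_ * _); rewrite /pos_coef big_nat_recr //=.
  by rewrite mulrCA mulfV ?mulr1// nz.
rewrite big_ltn ?ltnS ?(leq_trans le_in)// psum0 mul0r add0r.
apply: eq_big_nat => k /andP[ik kn]; rewrite mulrA; congr (_ * _).
rewrite mulrCA; congr (_ * _); rewrite /neg_coef big_ltn//.
by rewrite mulrA mulfV ?mul1r// nz.
Qed.

Lemma cut_sum0 w b i : cut_sum w b i i = w i.
Proof. by rewrite /cut_sum big_nat1 /neg_coef /pos_coef !big_geq// !mulr1. Qed.

(** The two terms of the recursion vanish by induction, or cancel when a single
    variable is left. In integrals: integrating from -1 to x, the result is 0 at
    x = -1. *)
Lemma cut_sum_alt b i n : (forall j k, (j < k)%N -> psum b j k != 0) ->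
  (i < n)%N -> cut_sum (fun k => (-1) ^+ k) b i n = 0.
Proof.
move=> nz; have [m] := ubnP (n - i)%N.
elim: m i n => [//|m IH] i [//|n] nim le_in.
have := @cut_sum_rec (fun k => (-1) ^+ k) b i n nz le_in.
suff e0 : cut_sum (fun k => (-1) ^+ k) b i n +
          cut_sum (fun k => (-1) ^+ k) b i.+1 n.+1 = 0.
  by rewrite e0 => /eqP; rewrite mulf_eq0 (negPf (nz i n.+1 le_in)) => /eqP.
move: le_in; rewrite ltnS leq_eqVlt => /predU1P[->|lt_in].
  by rewrite !cut_sum0 exprS mulN1r subrr.
by rewrite !IH ?addr0//; lia.
Qed.

Lemma cut_sum_shift w b i n :
  cut_sum w b i.+1 n.+1 = cut_sum (w \o S) (b \o S) i n.
Proof.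
rewrite /cut_sum big_add1 /=; apply: eq_big_nat => k /andP[ik kn].
congr (_ * _ * _); rewrite /neg_coef /pos_coef /psum big_add1 /=; apply: eq_big_nat => j _.
  by rewrite [in LHS]big_add1.
by rewrite [in LHS]big_add1.
Qed.

Lemma cut_sumZ a w b i n : cut_sum (fun k => a * w k) b i n = a * cut_sum w b i n.
Proof. by rewrite /cut_sum mulr_sumr; apply: eq_bigr => k _; rewrite !mulrA. Qed.

Lemma eq_cut_sum w w' b b' i n :
  (forall k, (i <= k < n.+1)%N -> w k = w' k) ->
  (forall k, (i <= k < n)%N -> b k = b' k) ->
  cut_sum w b i n = cut_sum w' b' i n.
Proof.
move=> ww bb; apply: eq_big_nat => k kin; rewrite ww//.
have bb' l r : (i <= l)%N -> (r <= n)%N -> psum b l r = psum b' l r.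
  by move=> il rn; apply: eq_big_nat => m mlr; apply: bb; lia.
by congr (_ * _ * _); apply: eq_big_nat => j jk; rewrite bb'//; lia.
Qed.

End chain_coefficients.

Section chain_integral.
Context {F : fieldType}.
Implicit Types (c : nat -> F * bool) (n : nat).

(** A letter (b, e) stands for the function sg(t)^e |t|^(b-1). *)
Definition parity c i := (-1) ^+ (\sum_(0 <= m < i) (c m).2)%N : F.
Definition chain c n := cut_sum (parity c) (fun k => (c k).1) 0 n.

Lemma eq_chain c c' n : (forall k, (k < n)%N -> c k = c' k) ->
  chain c n = chain c' n.
Proof.
move=> cc; apply: eq_cut_sum => k kn; last by rewrite cc.
by congr (_ ^+ _); apply: eq_big_nat => m mk; rewrite cc//; lia.
Qed.

(** The first letter, when it is removed, belongs to a negative variable for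
    every k that contributes, hence its sign. *)
Lemma chain_rec c n : (forall j k, (j < k)%N -> psum (fun k => (c k).1) j k != 0) ->
  psum (fun k => (c k).1) 0 n.+1 * chain c n.+1 =
  chain c n + (-1) ^+ (c 0%N).2 * chain (c \o S) n.
Proof.
move=> nz; rewrite /chain cut_sum_rec//; congr (_ + _).
rewrite cut_sum_shift -cut_sumZ; apply: eq_cut_sum => // k _ /=.
by rewrite /parity big_ltn// big_add1 /= exprD.
Qed.

End chain_integral.

(** P is meant to be the open right half-plane; a set that is closed under sums
    and avoids 0 is what keeps all the denominators nonzero. *)
Section alternating_chain.
Context {F : fieldType} (P : F -> Prop).
Hypotheses (P0 : ~ P 0) (P1 : P 1) (PD : forall x y, P x -> P y -> P (x + y)).

(** The default letter satisfies P, so that no partial sum vanishes even out of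
    range. *)
Definition extend n (c : 'I_n -> F * bool) (k : nat) : F * bool :=
  oapp c (1, false) (insub k).

Lemma extendE n (c : 'I_n -> F * bool) (i : 'I_n) : extend c i = c i.
Proof. by rewrite /extend valK. Qed.

Definition ochain n (c : 'I_n -> F * bool) := chain (extend c) n.

Definition altchain n (c : 'I_n -> F * bool) :=
  \sum_(s : 'S_n) (-1) ^+ s * ochain (c \o s).

Lemma P_psum b j k : (forall m, P (b m)) -> (j < k)%N -> P (psum b j k).
Proof.
move=> Pb; elim: k => [//|k IH]; rewrite ltnS leq_eqVlt => /predU1P[<-|jk].
  by rewrite /psum big_nat1.
by rewrite /psum big_nat_recr/= ?(ltnW jk)//; apply: PD => //; exact: IH.
Qed.

Lemma P_neq0 (z : F) : P z -> z != 0.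
Proof. by move=> Pz; apply/eqP => z0; rewrite z0 in Pz. Qed.

Lemma ochain_rec n (c : 'I_n.+1 -> F * bool) : (forall i, P (c i).1) ->
  (\sum_i (c i).1) * ochain c =
  ochain (c \o lift ord_max) + (-1) ^+ (c ord0).2 * ochain (c \o lift ord0).
Proof.
move=> Pc; rewrite /ochain.
have -> : \sum_i (c i).1 = psum (fun k => (extend c k).1) 0 n.+1.
  by rewrite /psum big_mkord; apply: eq_bigr => i _; rewrite extendE.
rewrite chain_rec => [|j k jk]; last first.
  apply/P_neq0/P_psum => // m; rewrite /extend.
  by case: insubP => [u _ _|_] //=; exact: Pc.
rewrite -[0%N]/(val (@ord0 n)) extendE; congr (_ + _ * _).
  apply: eq_chain => k kn; rewrite -[k]/(val (Ordinal kn)) extendE /=.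
  rewrite -[k]/(val (widen_ord (leqnSn n) (Ordinal kn))) extendE.
  by congr c; apply: val_inj; rewrite /= /bump leqNgt kn.
apply: eq_chain => k kn; rewrite -[k]/(val (Ordinal kn)) extendE /=.
by rewrite -[k.+1]/(bump 0 k) -[bump 0 k]/(val (lift ord0 (Ordinal kn))) extendE.
Qed.

Lemma eq_ochain n (c c' : 'I_n -> F * bool) : c =1 c' -> ochain c = ochain c'.
Proof.
move=> cc; apply: eq_chain => k kn.
by rewrite -[k]/(val (Ordinal kn)) !extendE.
Qed.

Let sign_lift (i j : nat) (t : bool) :
  (-1) ^+ (odd i (+) odd j (+) t) = (-1) ^+ i * (-1) ^+ j * (-1) ^+ t :> F.
Proof. by rewrite !signr_addb !signr_odd. Qed.

(** Moving the removed letter i to the first place costs (-1)^i, to the last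
    place (-1)^(n - i). *)
Lemma altchain_rec n (c : 'I_n.+1 -> F * bool) : (forall i, P (c i).1) ->
  (\sum_i (c i).1) * altchain c =
  \sum_(i < n.+1) (-1) ^+ i * ((-1) ^+ n + (-1) ^+ (c i).2) * altchain (c \o lift i).
Proof.
move=> Pc; rewrite /altchain mulr_sumr.
transitivity (\sum_(s : 'S_n.+1) (-1) ^+ s * ochain ((c \o s) \o lift ord_max) +
   \sum_(s : 'S_n.+1) (-1) ^+ s * ((-1) ^+ (c (s ord0)).2 * ochain ((c \o s) \o lift ord0))).
  rewrite -big_split; apply: eq_bigr => s _ /=.
  rewrite mulrCA -mulrDr -ochain_rec => [|i]; last exact: Pc.
  by congr (_ * (_ * _)); rewrite (reindex_inj (@perm_inj _ s)).
rewrite (sum_perm_lift ord_max) (sum_perm_lift ord0) -big_split.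
apply: eq_bigr => i _ /=; rewrite mulrDr mulrDl !mulr_sumr; congr (_ + _).
  apply: eq_bigr => s _; rewrite odd_lift_perm sign_lift.
  rewrite [X in _ = X]mulrA; congr (_ * _).
    by rewrite [X in X * _]mulrC.
  by apply: eq_ochain => k /=; rewrite lift_perm_lift.
apply: eq_bigr => s _; rewrite odd_lift_perm sign_lift expr0 mul1r.
rewrite lift_perm_id -!mulrA; congr (_ * _).
rewrite [LHS]mulrCA; congr (_ * (_ * _)).
by apply: eq_ochain => k /=; rewrite lift_perm_lift.
Qed.

Implicit Types x y : F * bool.

(** The sign makes the factor antisymmetric, as it has to be for the closed form
    to alternate like altchain. *)
Definition pair_factor x y : F :=
  if x.2 == y.2 then y.1 - x.1 else (-1) ^+ x.2 / (x.1 + y.1).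

Lemma pair_factorC x y : pair_factor y x = - pair_factor x y.
Proof.
rewrite /pair_factor eq_sym; case: eqVneq => [_|xy]; first by rewrite opprB.
rewrite [y.1 + _]addrC -mulNr; congr (_ / _).
by case: x.2 y.2 xy => [] []; rewrite ?expr0 ?expr1 ?opprK.
Qed.

Definition closed_form n (c : 'I_n -> F * bool) :=
  (\prod_(i < n | ~~ (c i).2) (c i).1)^-1 *
  \prod_(i < n) \prod_(j < n | (i < j)%N) pair_factor (c i) (c j).

(** Accumulates the signs left by Lagrange interpolation at the n steps of the
    recursion. *)
Fixpoint steps_sign n : F :=
  if n is m.+1 then (if odd m then 1 else (-1) ^+ m./2) * steps_sign m else 1.

Lemma pair_factor_neq0 x y : P x.1 -> P y.1 -> x != y -> pair_factor x y != 0.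
Proof.
move=> Px Py; case: x y Px Py => [x a] [y b] /= Px Py xy.
rewrite /pair_factor /=; case: (eqVneq a b) xy => [->|ab _].
  by rewrite xpair_eqE eqxx andbT subr_eq0 eq_sym.
by rewrite mulf_neq0 ?signr_eq0// invr_eq0; apply/P_neq0/PD.
Qed.

Lemma closed_form_lift n (c : 'I_n.+1 -> F * bool) (i : 'I_n.+1) :
  injective c -> (forall i, P (c i).1) ->
  closed_form (c \o lift i) =
  closed_form c * (-1) ^+ i * (if (c i).2 then 1 else (c i).1) /
    \prod_(j < n.+1 | j != i) pair_factor (c i) (c j).
Proof.
move=> injc Pc; rewrite /closed_form.
rewrite [X in _ = _ * X * _ * _ / _](prod_pairs_lift (Q := fun i j => pair_factor (c i) (c j)) i); last first.
  by move=> j k _; exact: pair_factorC.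
have -> : \prod_(j < n.+1 | ~~ (c j).2) (c j).1 =
   (if (c i).2 then 1 else (c i).1) * \prod_(j < n | ~~ (c (lift i j)).2) (c (lift i j)).1.
  case: ifPn => ci2; last by rewrite (bigD1_ord i).
  by rewrite big_mkcond (bigD1_ord i)//= ci2 /= mul1r mul1r -big_mkcond.
set p := \prod_(j < n.+1 | j != i) _.
have p0 : p != 0.
  apply/prodf_neq0 => j ji; apply: pair_factor_neq0 => //.
  by apply: contraNneq ji => /injc ->.
set e := if _ then _ else _.
have e0 : e != 0.
  by rewrite /e; case: ifP => _; rewrite ?oner_eq0// P_neq0.
set A := \prod_(_ < _ | _) _; set B := \prod_(_ < _) _.
rewrite invfM -[A^-1]/(A^-1).
have : (-1) ^+ i * (-1) ^+ i = 1 :> F by rewrite -expr2 sqrr_sign.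
set u := (-1) ^+ i => u1.
transitivity (A^-1 * B * (u * u)); first by rewrite u1 mulr1.
rewrite -[e^-1 * A^-1]mulrC; move: A^-1 => A'; field; exact/andP.
Qed.

(** The recursion of altchain, divided by the closed form. Writing b_j for the
    first components, pair_factor is a difference of b's inside the class of
    removable letters and the inverse of a sum b_i + b_j towards the other class,
    so this is Lagrange interpolation at the removable b_i. *)
Lemma sum_closed_form_lift m (c : 'I_m.+1 -> F * bool) :
  injective c -> (forall i, P (c i).1) ->
  #|[pred i | (c i).2]| = m.+1./2 ->
  \sum_(i < m.+1 | (c i).2 == odd m)
    (-1) ^+ m * (if (c i).2 then 1 else (c i).1) /
    \prod_(j < m.+1 | j != i) pair_factor (c i) (c j) =
  (if odd m then 1 else (-1) ^+ m./2) * \sum_(i < m.+1) (c i).1.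
Proof.
move=> injc Pc cardc.
pose I := [pred i | (c i).2 == odd m].
(* When m is even the factor b_i of the closed form is b_i - 0. *)
pose ys := (if odd m then [::] else [:: 0]) ++ [seq - (c j).1 | j : 'I_m.+1 in [predC I]].
have cardI : #|I| = (m./2).+1.
  have [om|om] := boolP (odd m).
    have -> : #|I| = #|[pred i | (c i).2]|.
      by apply: eq_card => i; rewrite !inE -[LHS]/((c i).2 == odd m) om eqb_id.
    by rewrite cardc -[in LHS](odd_double_half m) om; lia.
  have := cardC [pred i | (c i).2]; rewrite card_ord cardc.
  have -> : #|[predC [pred i | (c i).2]]| = #|I|.
    by apply: eq_card => i; rewrite -[RHS]/((c i).2 == odd m) (negPf om) !inE; case: (c i).2.
  have := odd_double_half m; rewrite (negPf om); move: #|I| => k; lia.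
have cardCI : #|[predC I]| = uphalf m.
  have := cardC I; rewrite card_ord cardI uphalf_half.
  have := odd_double_half m; move: #|[predC I]| => k; lia.
have szys : size ys = #|I|.
  rewrite size_cat size_map -cardE cardCI cardI uphalf_half.
  by case: (odd m).
have injI : {in I &, injective (fun i => (c i).1)}.
  move=> i j; rewrite !inE => /eqP ci /eqP cj cij; apply: injc.
  by rewrite [LHS]surjective_pairing [RHS]surjective_pairing cij ci cj.
have := sum_lagrange injI szys; rewrite cardI => /(_ isT).
have -> : \sum_(i in I) (c i).1 - \sum_(y <- ys) y = \sum_(i < m.+1) (c i).1.
  rewrite big_cat /= big_map big_enum /= sumrN.
  have -> : \sum_(j <- (if odd m then [::] else [:: 0])) j = 0 :> F.
    by case: ifP => _; rewrite ?big_nil ?big_seq1.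
  by rewrite add0r opprK [RHS](bigID (mem I)).
move=> <-; rewrite mulr_sumr; apply: eq_bigr => i ciI.
have bP j : (c i).1 + (c j).1 != 0 by apply/P_neq0/PD.
rewrite (bigID (mem I)) /=.
rewrite (eq_big (fun j => (j \in I) && (j != i)) (fun j => - ((c i).1 - (c j).1))); first last.
- move=> j /andP[_ /eqP cj]; rewrite opprB /pair_factor (eqP ciI) cj eqxx //.
- by move=> j; rewrite andbC.
rewrite prodrN.
have -> : #|[pred j | (j \in I) && (j != i)]| = m./2.
  have := cardD1 i I; rewrite cardI inE ciI add1n => -[->].
  by apply: eq_card => j; rewrite !inE andbC.
rewrite [X in _ / (_ * X)](eq_big (fun j => (j \in [predC I])) (fun j => (-1) ^+ m * ((c i).1 + (c j).1)^-1)); first last.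
- move=> j /andP[_]; rewrite !inE => cj.
  by rewrite /pair_factor (eqP ciI) eq_sym (negPf cj) signr_odd.
- move=> j; rewrite !inE; case: eqVneq => //= ->.
  by rewrite ciI.
rewrite big_split /= prodr_const cardCI prodfV.
rewrite big_cat /= big_map big_enum /=.
rewrite [X in _ = _ * (_ * X / _)](eq_bigr (fun j => (c i).1 + (c j).1)) => [|j _]; last first.
  by rewrite opprK.
set A := \prod_(_ in I | _) _; set B := \prod_(_ in _) _.
have -> : (if (c i).2 then 1 else (c i).1) =
  \prod_(j <- (if odd m then [::] else [:: 0])) ((c i).1 - j).
  rewrite (eqP ciI); case: ifP => _; rewrite ?big_nil// big_seq1 subr0//.
set E := \prod_(_ <- _) _.
rewrite !invfM invrK -!exprVn !invrN1 -exprM.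
have -> : (if odd m then 1 else (-1) ^+ m./2) =
   (-1) ^+ m * (-1) ^+ m./2 * (-1) ^+ (m * uphalf m) :> F.
  rewrite -!exprD -[RHS]signr_odd !oddD oddM uphalf_half oddD oddb.
  by case: (odd m) => /=; [case: (odd m./2)|rewrite addbF signr_odd].
ring.
Qed.

Lemma P_sum_ord m (f : 'I_m.+1 -> F) : (forall i, P (f i)) -> P (\sum_i f i).
Proof.
elim: m f => [|m IH] f Pf; first by rewrite big_ord1.
by rewrite big_ord_recr /=; apply: PD => //; apply: IH.
Qed.

Lemma card_lift n (p : pred 'I_n.+1) i :
  (#|[pred j | p j]| = p i + #|[pred j | p (lift i j)]|)%N.
Proof.
rewrite -!sum1_card ![(\sum_(_ in _) 1)%N]big_mkcond (bigD1_ord i)//=.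
Qed.

(** The hypothesis on the number of odd letters is the one which is preserved
    when a letter of the parity of m is removed from m + 1 letters. *)
Theorem altchain_closed_form n (c : 'I_n -> F * bool) :
  injective c -> (forall i, P (c i).1) ->
  #|[pred i | (c i).2]| = n./2 ->
  altchain c = steps_sign n * 2 ^+ n * closed_form c.
Proof.
elim: n c => [|m IH] c injc Pc cardc.
  rewrite /altchain /closed_form !big_ord0 /= expr0 invr1 !mulr1.
  rewrite (big_pred1 1%g) => [|s]; last by apply/esym/eqP/permP => -[].
  rewrite odd_perm1 mul1r /ochain /chain cut_sum0 /parity.
  by rewrite big_geq.
have sum_neq0 : \sum_(i < m.+1) (c i).1 != 0 by apply/P_neq0/P_sum_ord.
apply: (mulfI sum_neq0); rewrite altchain_rec//.
transitivity (\sum_(i < m.+1 | (c i).2 == odd m)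
   (2 ^+ m.+1 * steps_sign m * closed_form c) * ((-1) ^+ m * (if (c i).2 then 1 else (c i).1) /
    \prod_(j < m.+1 | j != i) pair_factor (c i) (c j))).
  rewrite [RHS]big_mkcond; apply: eq_bigr => i _; case: eqP => ci; last first.
    rewrite -(signr_odd _ m).
    by case: (odd m) (c i).2 ci => [] []; rewrite // ?subrr ?addNr ?(mulr0, mul0r).
  rewrite IH; first last.
  - by have := card_lift (fun j => (c j).2) i; rewrite cardc ci -[m.+1./2]/(uphalf m) uphalf_half => /addnI <-.
  - by move=> j; exact: Pc.
  - by move=> j k /injc/lift_inj.
  rewrite closed_form_lift// ci signr_odd exprS.
  have : (-1) ^+ i * (-1) ^+ i = 1 :> F by rewrite -expr2 sqrr_sign.
  set u := (-1) ^+ i; set p := \prod_(_ < _ | _) _ => u1.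
  set e := if _ then _ else _.
  transitivity ((u * u) * (2 * 2 ^+ m * steps_sign m * closed_form c * ((-1) ^+ m * e / p))).
    ring.
  by rewrite u1 mul1r.
rewrite -mulr_sumr sum_closed_form_lift//= exprS.
ring.
Qed.

End alternating_chain.

(** * Integration of complex powers on the half-line *)

Section one_variable.
Context {R : realType}.
Notation mu := (@lebesgue_measure R).

(** The integral of f up to x is continuous on the closed interval because f is
    integrable, even if f is unbounded near a or b; its difference with F has
    zero derivative inside. *)
Lemma integrable_FTC2 (f F : R -> R) a b : a < b ->
  mu.-integrable `[a, b] (EFin \o f) ->
  {in `]a, b[, continuous f} ->
  {within `[a, b], continuous F} ->
  (forall x, x \in `]a, b[ -> is_derive x 1 F (f x)) ->
  \int[mu]_(x in `[a, b]) f x = F b - F a.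
Proof.
move=> ab intf cf cF dF.
pose G x := \int[mu]_(t in `[a, x]) f t.
have cG : {within `[a, b], continuous G}.
  exact: parameterized_integral_continuous (ltW ab) intf.
have dG x : x \in `]a, b[ -> is_derive x 1 G (f x).
  move=> xab; have := xab; rewrite in_itv /= => /andP[ax xb].
  have [dGx G'x] := continuous_FTC1_closed xb intf ax (cf _ xab).
  by split; [exact: dGx|rewrite -derive1E].
have [] := @MVT R (F \- G) (fun=> 0) a b ab.
- move=> x xab; have := dF _ xab; have := dG _ xab => dGx dFx.
  apply: is_derive_eq; by rewrite subrr.
- move=> x; apply: cvgB; [exact: cF|exact: cG].
move=> x _; rewrite mul0r /= => /eqP.
rewrite {2}/G set_itv1 Rintegral_set1 subr0 subr_eq0 subr_eq => /eqP.
move=> ->; rewrite /G; ring.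
Qed.

(** Monotone convergence along [1 / (i + 2), 1], where the integrals are at most
    1 / r. *)
Lemma integrable_powR (r : R) : 0 < r ->
  mu.-integrable `[0, 1] (EFin \o (fun y : R => y `^ (r - 1))).
Proof.
move=> r0.
have mpow (D : set R) : measurable_fun D (EFin \o (fun y : R => y `^ (r - 1))).
  apply/measurable_EFinP; apply: measurable_funTS; exact: measurable_powR.
apply/integrableP; split; first exact: mpow.
under eq_integral do rewrite /= ger0_norm ?powR_ge0//.
rewrite -integral_itv_obnd_cbnd; last exact: mpow.
(* 1 / (i + 2) and not 1 / (i + 1): the interval must have nonempty interior. *)
pose D i : set R := `[i.+2%:R^-1, 1]%classic.
have ndD : nondecreasing_seq D.
  move=> i j ij; rewrite subsetEset; apply: subset_itvr.
  by rewrite bnd_simp lef_pV2 ?posrE// ler_nat ltnS.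
have UD : \bigcup_i D i = `]0, 1]%classic.
  apply/seteqP; split => y /=.
    move=> [i _]; rewrite /D /= !in_itv/= => /andP[iy ->]; rewrite andbT.
    by apply: lt_le_trans iy; rewrite invr_gt0.
  rewrite in_itv/= => /andP[y0 y1].
  exists (Num.truncn y^-1); first by [].
  rewrite /D/= in_itv/= y1 andbT invf_ple ?posrE//.
  apply: (le_trans (ltW (truncnS_gt _))).
  by rewrite ler_nat.
have pow0 i x : D i x -> (0 <= (x `^ (r - 1))%:E)%E.
  by rewrite lee_fin powR_ge0.
have Dint i : (\int[mu]_(x in D i) (x `^ (r - 1))%:E <= (r^-1)%:E)%E.
  have i0 : 0 < i.+2%:R^-1 :> R by rewrite invr_gt0.
  have i1 : i.+2%:R^-1 < 1 :> R by rewrite invf_lt1// ltr1n.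
  have dF (x : R) : 0 < x -> is_derive x 1 (fun x => r^-1 * x `^ r) (x `^ (r - 1)).
    move=> x0; have dpow := is_derive1_powR r x0.
    apply: is_derive_eq; rewrite /GRing.scale /= mulrA mulVf ?mul1r// gt_eqF//.
  have cpow (x p : R) : 0 < x -> {for x, continuous (fun y : R => y `^ p)}.
    move=> x0; have [dx _] := is_derive1_powR p x0.
    exact/differentiable_continuous/derivable1_diffP.
  rewrite (@continuous_FTC2 _ _ (fun x => r^-1 * x `^ r))//.
  - by rewrite powR1 -EFinB lee_fin mulr1 lerBlDl lerDr mulr_ge0 ?invr_ge0 ?powR_ge0// ltW.
  - apply: continuous_in_subspaceT => x; rewrite inE /= in_itv/= => /andP[ix _].
    by apply: cpow; apply: lt_le_trans ix.
  - split.
    + move=> x; rewrite in_itv/= => /andP[ix _].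
      by have [] := dF x (lt_trans i0 ix).
    + apply: cvg_at_right_filter; apply: cvgMr; exact: cpow.
    + by apply: cvg_at_left_filter; apply: cvgMr; exact: cpow.
  - move=> x; rewrite in_itv/= => /andP[ix _].
    by have [_ <-] := dF x (lt_trans i0 ix); rewrite derive1E.
rewrite -UD.
have cvgD : (\int[mu]_(x in D i) (x `^ (r - 1))%:E @[i --> \oo] -->
    \int[mu]_(x in \bigcup_i D i) (x `^ (r - 1))%:E)%E.
  apply: ge0_nondecreasing_set_cvg_integral => //.
  - by move=> i; exact: measurable_itv.
  - by move=> i; exact: mpow.
apply: (@le_lt_trans _ _ (r^-1)%:E); last exact: ltry.
rewrite -(cvg_lim _ cvgD)//.
apply: lime_le; first by apply/cvg_ex; eexists; exact: cvgD.
exact: nearW.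
Qed.

(** Real and imaginary parts of t ^ (r + i q). *)
Definition pcos (r q t : R) : R := t `^ r * cos (q * ln t).
Definition psin (r q t : R) : R := t `^ r * sin (q * ln t).

Lemma is_derive_pcos (r q t : R) : 0 < t ->
  is_derive t 1 (pcos r q) (r * pcos (r - 1) q t - q * psin (r - 1) q t).
Proof.
move=> t0; have dln := is_derive1_ln t0; have dpow := is_derive1_powR r t0.
have dcos : is_derive t 1 (fun t => cos (q * ln t)) (- sin (q * ln t) * (q * t^-1)).
  apply: (@is_derive1_comp _ cos (fun t => q * ln t)).
apply: is_derive_eq.
have -> : t `^ r = t * t `^ (r - 1).
  by rewrite -{2}(powRr1 (ltW t0)) -powRD ?(gt_eqF t0) ?implybT// addrC subrK.
rewrite /pcos /psin /GRing.scale /=; field; exact: lt0r_neq0.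
Qed.

Lemma is_derive_psin (r q t : R) : 0 < t ->
  is_derive t 1 (psin r q) (q * pcos (r - 1) q t + r * psin (r - 1) q t).
Proof.
move=> t0; have dln := is_derive1_ln t0; have dpow := is_derive1_powR r t0.
have dsin : is_derive t 1 (fun t => sin (q * ln t)) (cos (q * ln t) * (q * t^-1)).
  apply: (@is_derive1_comp _ sin (fun t => q * ln t)).
apply: is_derive_eq.
have -> : t `^ r = t * t `^ (r - 1).
  by rewrite -{2}(powRr1 (ltW t0)) -powRD ?(gt_eqF t0) ?implybT// addrC subrK.
rewrite /pcos /psin /GRing.scale /=; field; exact: lt0r_neq0.
Qed.

Lemma measurable_pcos (r q : R) : measurable_fun setT (pcos r q).
Proof.
apply: measurable_funM; first exact: measurable_powR.
apply: (@measurableT_comp _ _ _ _ _ _ (@cos R) _ (fun t => q * ln t)).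
  by apply: continuous_measurable_fun; exact: continuous_cos.
by apply: measurable_funM => //; exact: measurable_ln.
Qed.

Lemma measurable_psin (r q : R) : measurable_fun setT (psin r q).
Proof.
apply: measurable_funM; first exact: measurable_powR.
apply: (@measurableT_comp _ _ _ _ _ _ (@sin R) _ (fun t => q * ln t)).
  by apply: continuous_measurable_fun; exact: continuous_sin.
by apply: measurable_funM => //; exact: measurable_ln.
Qed.

Lemma norm_mul_le1 (a b : R) : `|b| <= 1 -> 0 <= a -> `|a * b| <= a.
Proof. by move=> b1 a0; rewrite normrM (ger0_norm a0) ler_piMr. Qed.

Lemma normr_pcos_le (r q t : R) : `|pcos r q t| <= t `^ r.
Proof.
by apply: norm_mul_le1; rewrite ?powR_ge0// ler_norml cos_geN1 cos_le1.
Qed.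

Lemma normr_psin_le (r q t : R) : `|psin r q t| <= t `^ r.
Proof.
by apply: norm_mul_le1; rewrite ?powR_ge0// ler_norml sin_geN1 sin_le1.
Qed.

Lemma pcos0 (r q : R) : 0 < r -> pcos r q 0 = 0.
Proof. by move=> r0; rewrite /pcos powR0 ?mul0r// gt_eqF. Qed.

Lemma psin0 (r q : R) : 0 < r -> psin r q 0 = 0.
Proof. by move=> r0; rewrite /psin powR0 ?mul0r// gt_eqF. Qed.

Lemma within_continuous_dominated_powR (r : R) (F : R -> R) x : 0 < r -> 0 < x ->
  (forall t, `|F t| <= t `^ r) -> (forall t, 0 < t -> derivable F t 1) ->
  {within `[0, x], continuous F}.
Proof.
move=> r0 x0 Fr dF.
have cF t : 0 < t -> {for t, continuous F}.
  by move=> t0; apply/differentiable_continuous/derivable1_diffP/dF.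
have F0 : F 0 = 0.
  by apply/eqP; rewrite -normr_le0 (le_trans (Fr 0))// powR0 ?gt_eqF.
apply/continuous_within_itvP => //; split.
- by move=> t; rewrite in_itv/= => /andP[t0 _]; exact: cF.
- rewrite F0; apply: norm_cvg0.
  apply: (@squeeze_cvgr _ _ _ _ (fun=> 0) (fun t => t `^ r)).
  + by near=> t; rewrite normr_ge0 Fr.
  + exact: cvg_cst.
  + exact: powR_cvg0.
- by apply: cvg_at_left_filter; exact: cF.
Unshelve. all: by end_near. Qed.

Lemma integrable_dominated_powR (r : R) (f : R -> R) x : 0 < r -> x <= 1 ->
  measurable_fun setT f ->
  (forall t, `|f t| <= t `^ (r - 1)) ->
  mu.-integrable `[0, x] (EFin \o f).
Proof.
move=> r0 x1 mf fr.
apply: (@integrableS _ _ _ mu `[0, 1]%classic `[0, x]%classic) => //.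
  by apply: subset_itvl; rewrite bnd_simp.
apply: (le_integrable _ _ _ (integrable_powR r0)) => //.
  by apply/measurable_EFinP; exact: measurable_funTS.
by move=> t _; rewrite /= lee_fin [leRHS]ger0_norm ?powR_ge0.
Qed.

(** Real and imaginary parts of b * (integral of t^(b - 1) from 0 to x) = x^b,
    where b = r + i q. *)
Lemma integral_pcos_psin (r q x : R) : 0 < r -> 0 < x <= 1 ->
  let C := \int[mu]_(t in `[0, x]) pcos (r - 1) q t in
  let S := \int[mu]_(t in `[0, x]) psin (r - 1) q t in
  r * C - q * S = pcos r q x /\ q * C + r * S = psin r q x.
Proof.
move=> r0 /andP[x0 x1] C S.
have ic := integrable_dominated_powR r0 x1 (measurable_pcos (r - 1) q) (normr_pcos_le (r - 1) q).
have iS := integrable_dominated_powR r0 x1 (measurable_psin (r - 1) q) (normr_psin_le (r - 1) q).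
have icZ k : mu.-integrable `[0, x] (EFin \o (fun t => k * pcos (r - 1) q t)).
  exact: (integrableZl _ k ic).
have isZ k : mu.-integrable `[0, x] (EFin \o (fun t => k * psin (r - 1) q t)).
  exact: (integrableZl _ k iS).
have cc p t : 0 < t -> {for t, continuous (pcos p q)}.
  by move=> t0; have [dt _] := is_derive_pcos p q t0; exact/differentiable_continuous/derivable1_diffP.
have cs p t : 0 < t -> {for t, continuous (psin p q)}.
  by move=> t0; have [dt _] := is_derive_psin p q t0; exact/differentiable_continuous/derivable1_diffP.
split.
- rewrite -!RintegralZl// -RintegralB//.
  rewrite (_ : pcos r q x = pcos r q x - pcos r q 0); last by rewrite pcos0// subr0.
  apply: integrable_FTC2 => //.
  + exact: (integrableB _ (icZ r) (isZ q)).
  + move=> t; rewrite in_itv/= => /andP[t0 _].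
    by apply: cvgB; apply: cvgMr; [exact: cc|exact: cs].
  + apply: (within_continuous_dominated_powR r0 x0); first exact: normr_pcos_le.
    by move=> t t0; have [] := is_derive_pcos r q t0.
  + by move=> t; rewrite in_itv/= => /andP[t0 _]; exact: is_derive_pcos.
- rewrite -!RintegralZl// -RintegralD//.
  rewrite (_ : psin r q x = psin r q x - psin r q 0); last by rewrite psin0// subr0.
  apply: integrable_FTC2 => //.
  + exact: (integrableD _ (icZ q) (isZ r)).
  + move=> t; rewrite in_itv/= => /andP[t0 _].
    by apply: cvgD; apply: cvgMr; [exact: cc|exact: cs].
  + apply: (within_continuous_dominated_powR r0 x0); first exact: normr_psin_le.
    by move=> t t0; have [] := is_derive_psin r q t0.
  + by move=> t; rewrite in_itv/= => /andP[t0 _]; exact: is_derive_psin.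
Qed.

End one_variable.

(** * Signed powers on the interval from -1 to 1 *)

Section reflection.
Context {R : realType}.
Notation mu := (@lebesgue_measure R).

Lemma ge0_integral_opp (f : R -> R) a b : measurable_fun setT f ->
  (forall t, 0 <= f t) ->
  (\int[mu]_(t in `]a, b]) (f t)%:E = \int[mu]_(t in `[(- b)%R, (- a)%R[) (f (- t))%:E)%E.
Proof.
move=> mf f0.
rewrite (eq_measure_integral (pushforward mu (-%R : measurableTypeR R -> measurableTypeR R))); last first.
  by move=> A mA _; exact/esym/lebesgue_measureN.
rewrite ge0_integral_pushforward//.
- by rewrite opp_preimage_itvbndbnd.
- by apply/measurable_EFinP; exact: measurable_funTS.
- by move=> t _; rewrite lee_fin.
Qed.

Lemma Rintegral_opp (f : R -> R) a b : measurable_fun setT f ->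
  mu.-integrable `[- b, - a[ (EFin \o (fun t => f (- t))) ->
  \int[mu]_(t in `]a, b]) f t = \int[mu]_(t in `[- b, - a[) f (- t).
Proof.
move=> mf intf; rewrite /Rintegral; congr fine.
rewrite (eq_measure_integral (pushforward mu (-%R : measurableTypeR R -> measurableTypeR R))); last first.
  by move=> A mA _; exact/esym/lebesgue_measureN.
rewrite integral_pushforward//.
- by rewrite opp_preimage_itvbndbnd.
- exact/measurable_EFinP.
- by rewrite opp_preimage_itvbndbnd.
Qed.

Lemma integrable_norm_powR (r : R) : 0 < r ->
  mu.-integrable `[- 1, 1] (EFin \o (fun t : R => `|t| `^ (r - 1))).
Proof.
move=> r0; have mW : measurable_fun setT (fun t : R => `|t| `^ (r - 1)).
  exact: (measurableT_comp (measurable_powR (r - 1)) (@normr_measurable R setT)).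
have ipow : (\int[mu]_(t in `[0%R, 1%R]) (`|t| `^ (r - 1))%:E < +oo)%E.
  have /integrableP[_] := integrable_powR r0; congr (_ < _)%E.
  apply: eq_integral => t; rewrite inE/= in_itv/= => /andP[t0 _].
  by rewrite !ger0_norm ?powR_ge0.
apply/integrableP; split; first by apply/measurable_EFinP; exact: measurable_funTS.
under eq_integral do rewrite /= ger0_norm ?powR_ge0//.
rewrite (@itv_bndbnd_setU _ _ _ (BLeft 0)) ?bnd_simp// ge0_integral_setU//=; first last.
- apply/disj_setPS => t [/=]; rewrite !in_itv/= => /andP[_ t0] /andP[].
  by rewrite leNgt t0.
- by apply/measurable_EFinP; exact: measurable_funTS.
apply: lte_add_pinfty => //.
have := @ge0_integral_opp _ 0 1 mW (fun=> powR_ge0 _ _).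
under [X in _ = X]eq_integral do rewrite normrN.
rewrite oppr0 => <-; rewrite integral_itv_obnd_cbnd//.
by apply/measurable_EFinP; exact: measurable_funTS.
Qed.

(** Reflecting the negative half-line reduces everything to integrals of g from
    0; the primitive of a function of sign sg(t)^d has sign sg(t)^(d + 1). *)
Lemma Rintegral_signed (g : R -> R) d x : -1 <= x <= 1 ->
  measurable_fun setT g ->
  mu.-integrable `[-1, 1] (EFin \o (fun t : R => g `|t|)) ->
  let h t := Num.sg t ^+ d * g `|t| in
  mu.-integrable `[-1, 1] (EFin \o h) /\
  \int[mu]_(t in `[-1, x]) h t =
    Num.sg x ^+ d.+1 * \int[mu]_(t in `[0, `|x|]) g t
    - (-1) ^+ d.+1 * \int[mu]_(t in `[0, 1]) g t.
Proof.
move=> /andP[x1 x2] mg ig h.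
have msg : measurable_fun setT (@Num.sg _ : R -> R).
  rewrite (_ : Num.sg = fun t : R => if t == 0 then 0 else if t < 0 then -1 else 1); last first.
    by apply/funext => t; case: sgrP => // t0; rewrite ?gt_eqF// ?lt_eqF ?ltNge ?(ltW t0).
  apply: measurable_fun_ifT => //; first exact: measurable_fun_eqr.
  apply: measurable_fun_ifT => //; exact: measurable_fun_ltr.
have mgn : measurable_fun setT (fun t : R => g `|t|).
  exact: (measurableT_comp mg (@normr_measurable R setT)).
have mh : measurable_fun setT h.
  by apply: measurable_funM => //; exact: measurable_funX.
have ih : mu.-integrable `[-1, 1] (EFin \o h).
  apply: (le_integrable _ _ _ ig) => //.
    by apply/measurable_EFinP; exact: measurable_funTS.
  move=> t _; rewrite /= lee_fin /h normrM ler_piMl// normrX exprn_ile1//.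
  by rewrite normr_sg lern1 leq_b1.
split => //.
have ig01 y : y <= 1 -> mu.-integrable `[0, y] (EFin \o g).
  move=> y1; have : mu.-integrable `[0, y] (EFin \o (fun t : R => g `|t|)).
    by apply: (integrableS _ _ _ ig) => //; apply: subset_itv; rewrite bnd_simp// ?lerN10.
  apply: eq_integrable => // t; rewrite inE/= in_itv/= => /andP[t0 _].
  by rewrite ger0_norm.
(* On the negative half-line t = - u turns h into (-1) ^ d * g. *)
have neg y : 0 <= y <= 1 -> \int[mu]_(t in `[-1, - y[) h t =
    (-1) ^+ d * (\int[mu]_(t in `[0, 1]) g t - \int[mu]_(t in `[0, y]) g t).
  move=> /andP[y0 y1].
  have i01 : mu.-integrable `]y, 1] (EFin \o g).
    by apply: (integrableS _ _ _ (ig01 1 (lexx _))) => //; apply: subset_itv; rewrite bnd_simp.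
  rewrite Rintegral_itvB ?bnd_simp//; last exact: ig01.
  rewrite -RintegralZl// -[LHS]/(\int[mu]_(t in `[-1, - y[) h t).
  transitivity (\int[mu]_(t in `[- 1, - y[) (fun t => h (- t)) (- t)).
    by apply: eq_Rintegral => t _; rewrite opprK.
  rewrite -(@Rintegral_opp (fun t => h (- t)) y 1).
  - apply: eq_Rintegral => t; rewrite inE/= in_itv/= => /andP[yt _].
    have t0 : 0 < t by apply: le_lt_trans yt.
    by rewrite /h sgrN gtr0_sg// normrN gtr0_norm.
  - apply: (measurableT_comp mh); exact: oppr_measurable.
  - apply: (@eq_integrable _ _ _ mu _ _ (EFin \o h)) => //.
      by move=> t _; rewrite /= opprK.
    by apply: (integrableS _ _ _ ih) => //; apply: subset_itv; rewrite bnd_simp// lerNl (le_trans _ y0)// lerN10.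
have hx y : y <= 1 -> mu.-integrable `[-1, y] (EFin \o h).
  move=> y1; by apply: (integrableS _ _ _ ih) => //; apply: subset_itv; rewrite bnd_simp.
have hxo y : y <= 1 -> mu.-integrable `[-1, y[ (EFin \o h).
  move=> y1; by apply: (integrableS _ _ _ ih) => //; apply: subset_itv; rewrite bnd_simp.
have [x0|x0|->] := ltgtP x 0.
- rewrite -Rintegral_itv_bndo_bndc; last exact: hxo.
  rewrite -{1}[x]opprK neg ?oppr_ge0 ?(ltW x0) 1?lerNl//.
  rewrite ltr0_sg// ltr0_norm// exprS; ring.
- rewrite (@itv_bndbnd_setU _ _ _ (BLeft 0)) ?bnd_simp ?(ltW x0)// ?lerN10//.
  rewrite Rintegral_setU//=; first last.
  + apply/disj_setPS => t [/=]; rewrite !in_itv/= => /andP[_ t0] /andP[].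
    by rewrite leNgt t0.
  + rewrite -itv_bndbnd_setU ?bnd_simp ?(ltW x0)// ?lerN10//; exact: hx.
  rewrite -{1}oppr0 neg ?lexx ?ler01// set_itv1 Rintegral_set1 subr0.
  rewrite gtr0_sg// expr1n mul1r gtr0_norm// exprS mulN1r mulNr opprK addrC; congr (_ + _).
  rewrite -!Rintegral_itv_obnd_cbnd; first last.
  + by apply: (integrableS _ _ _ (hx x x2)) => //; apply: subset_itv; rewrite bnd_simp// lerN10.
  + by apply: (integrableS _ _ _ (ig01 x x2)) => //; apply: subset_itv; rewrite bnd_simp.
  apply: eq_Rintegral => t; rewrite inE/= in_itv/= => /andP[t0 _].
  by rewrite /h gtr0_sg// expr1n mul1r gtr0_norm.
- rewrite -Rintegral_itv_bndo_bndc; last by apply: hxo.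
  rewrite -{1}oppr0 neg ?lexx ?ler01// set_itv1 normr0 set_itv1 !Rintegral_set1 mulr0 exprS; ring.
Qed.

End reflection.

(** * Complex-valued integrals *)

Section complex_parts.
Context {R : realType}.
Implicit Types z w : R[i].

Lemma cReD z w : complex.Re (z + w) = complex.Re z + complex.Re w.
Proof. by case: z w => [a b] [c d]. Qed.
Lemma cImD z w : complex.Im (z + w) = complex.Im z + complex.Im w.
Proof. by case: z w => [a b] [c d]. Qed.
Lemma cReM z w : complex.Re (z * w) =
  complex.Re z * complex.Re w - complex.Im z * complex.Im w.
Proof. by case: z w => [a b] [c d]. Qed.
Lemma cImM z w : complex.Im (z * w) =
  complex.Re z * complex.Im w + complex.Im z * complex.Re w.
Proof. by case: z w => [a b] [c d]. Qed.
Lemma cReN z : complex.Re (- z) = - complex.Re z.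
Proof. by case: z. Qed.
Lemma cImN z : complex.Im (- z) = - complex.Im z.
Proof. by case: z. Qed.

Lemma complexP z w : complex.Re z = complex.Re w -> complex.Im z = complex.Im w -> z = w.
Proof. by case: z w => [a b] [c d] /= -> ->. Qed.

End complex_parts.

Section complex_integral.
Context {R : realType} {d : measure_display} {T : measurableType d}.
Variables (mu : {measure set T -> \bar R}) (D : set T).
Hypothesis mD : measurable D.
Implicit Types (f g : T -> R[i]) (c : R[i]).

Lemma cintegrableD f g : cintegrable mu D f -> cintegrable mu D g ->
  cintegrable mu D (fun x => f x + g x).
Proof.
move=> [rf jf] [rg jg]; split.
- apply: (eq_integrable mD _ _ _ (integrableD mD rf rg)) => // x _.
  by rewrite /= cReD.
- apply: (eq_integrable mD _ _ _ (integrableD mD jf jg)) => // x _.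
  by rewrite /= cImD.
Qed.

Lemma cintegralD f g : cintegrable mu D f -> cintegrable mu D g ->
  cintegral mu D (fun x => f x + g x) = cintegral mu D f + cintegral mu D g.
Proof.
move=> [rf jf] [rg jg]; apply: complexP; rewrite /= -RintegralD//.
- by apply: eq_Rintegral => x _; rewrite cReD.
- by apply: eq_Rintegral => x _; rewrite cImD.
Qed.

Lemma cintegrableZ c f : cintegrable mu D f -> cintegrable mu D (fun x => c * f x).
Proof.
move=> [rf jf]; split.
- apply: (eq_integrable mD _ _ _ (integrableB mD (integrableZl mD (complex.Re c) rf) (integrableZl mD (complex.Im c) jf))) => // x _.
  by rewrite /= cReM.
- apply: (eq_integrable mD _ _ _ (integrableD mD (integrableZl mD (complex.Re c) jf) (integrableZl mD (complex.Im c) rf))) => // x _.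
  by rewrite /= cImM.
Qed.

Lemma cintegralZ c f : cintegrable mu D f ->
  cintegral mu D (fun x => c * f x) = c * cintegral mu D f.
Proof.
move=> [rf jf]; apply: complexP; rewrite /= ?cReM ?cImM /= -!RintegralZl//.
- rewrite -RintegralB//; first by apply: eq_Rintegral => x _; rewrite cReM.
    exact: (integrableZl mD (complex.Re c) rf).
  exact: (integrableZl mD (complex.Im c) jf).
- rewrite -RintegralD//; first by apply: eq_Rintegral => x _; rewrite cImM.
    exact: (integrableZl mD (complex.Re c) jf).
  exact: (integrableZl mD (complex.Im c) rf).
Qed.

Lemma cintegrable0 : cintegrable mu D (fun=> 0).
Proof. by split; exact: integrable0. Qed.

Lemma cintegral0 : cintegral mu D (fun=> 0) = 0.
Proof. by rewrite /cintegral /Rintegral /= integral0. Qed.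

Lemma eq_cintegral f g : {in D, f =1 g} -> cintegral mu D f = cintegral mu D g.
Proof.
by move=> fg; apply: complexP; apply: eq_Rintegral => x xD; rewrite fg.
Qed.

Lemma eq_cintegrable f g : {in D, f =1 g} -> cintegrable mu D f -> cintegrable mu D g.
Proof.
move=> fg [rf jf]; split; [move: rf|move: jf]; apply: eq_integrable => // x xD.
  by rewrite fg.
by rewrite fg.
Qed.

Lemma cintegrable_sum I (r : seq I) (F : I -> T -> R[i]) :
  (forall i, cintegrable mu D (F i)) ->
  cintegrable mu D (fun x => \sum_(i <- r) F i x).
Proof.
move=> iF; elim: r => [|i r IH].
  by apply: (eq_cintegrable _ cintegrable0) => x _; rewrite big_nil.
by apply: (eq_cintegrable _ (cintegrableD (iF i) IH)) => x _; rewrite big_cons.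
Qed.

Lemma cintegral_sum I (r : seq I) (F : I -> T -> R[i]) :
  (forall i, cintegrable mu D (F i)) ->
  cintegral mu D (fun x => \sum_(i <- r) F i x) = \sum_(i <- r) cintegral mu D (F i).
Proof.
move=> iF; elim: r => [|i r IH].
  rewrite big_nil -[RHS]cintegral0; apply: eq_cintegral => x _.
  by rewrite big_nil.
rewrite big_cons -IH -cintegralD//; last exact: cintegrable_sum.
by apply: eq_cintegral => x _; rewrite big_cons.
Qed.

End complex_integral.

Section signed_powers.
Context {R : realType}.
Notation mu := (@lebesgue_measure R).
Implicit Types (b c : R[i]) (t x : R).

(** Equal to cpowR for t > 0, but with real and imaginary parts given by a single
    formula, including at the origin. *)
Definition cpower b t : R[i] :=
  Complex (pcos (complex.Re b) (complex.Im b) t) (psin (complex.Re b) (complex.Im b) t).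

Definition signed_cpower b e t : R[i] := (Num.sg t ^+ e)%:C%C * cpower b `|t|.

Lemma cpowR_cpower b t : 0 < t -> cpowR t b = cpower b t.
Proof.
move=> t0; rewrite /cpowR gt_eqF// /cexp /cpower /pcos /psin /powR gt_eqF//.
rewrite cReM cImM /= !mulr0 subr0 add0r.
by rewrite [complex.Re b * _]mulrC; congr Complex; congr (_ * _).
Qed.

Lemma cpowerD b c t : 0 < t -> cpower (b + c) t = cpower b t * cpower c t.
Proof.
move=> t0; apply: complexP; rewrite ?cReM ?cImM /= cReD cImD /pcos /psin mulrDl ?cosD ?sinD.
  rewrite (powRD (x := t)); last by rewrite (gt_eqF t0) implybT.
  ring.
rewrite (powRD (x := t)); last by rewrite (gt_eqF t0) implybT.
ring.
Qed.

Lemma cpower_nat k t : 0 <= t -> cpower k%:R t = (t ^+ k)%:C%C.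
Proof.
move=> t0; have -> : (k%:R : R[i]) = (k%:R)%:C%C by rewrite rmorph_nat.
by rewrite /cpower /pcos /psin /= mul0r cos0 sin0 powR_mulrn// mulr1 mulr0.
Qed.

Lemma cpower1 b : cpower b 1 = 1.
Proof. by rewrite /cpower /pcos /psin ln1 mulr0 cos0 sin0 powR1 !mulr1 mulr0. Qed.

Lemma signed_cpowerM b c e e' t : t != 0 ->
  signed_cpower b e t * signed_cpower c e' t = signed_cpower (b + c) (e + e') t.
Proof.
move=> t0; rewrite /signed_cpower cpowerD ?normr_gt0// exprD rmorphM; ring.
Qed.

Lemma mul_cpowR_exp b k t : t != 0 ->
  cpowR `|t| b * (t ^+ k)%:C%C = signed_cpower (b + k%:R) k t.
Proof.
move=> t0; rewrite cpowR_cpower ?normr_gt0// /signed_cpower cpowerD ?normr_gt0//.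
rewrite cpower_nat//.
have -> : t ^+ k = Num.sg t ^+ k * `|t| ^+ k by rewrite -exprMn -numEsg.
rewrite rmorphM mulrCA; congr (_ * _).
Qed.

Lemma real_complex_sign e : ((-1) ^+ e : R)%:C%C = (-1) ^+ e.
Proof. by rewrite rmorphXn /= rmorphN rmorph1. Qed.

Lemma cintegral_cpower b x : 0 < complex.Re b -> 0 <= x <= 1 ->
  b * cintegral mu `[0, x] (cpower (b - 1)) = cpower b x.
Proof.
move=> b0 /andP[]; rewrite le_eqVlt => /predU1P[<- _|x0 x1].
  rewrite /cintegral set_itv1 !Rintegral_set1 /cpower pcos0// psin0//.
  by rewrite -[X in _ * X]/(0 : R[i]) mulr0.
have [|eC eS] := @integral_pcos_psin R _ (complex.Im b) x b0; first by rewrite x0.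
have rb : complex.Re (b - 1) = complex.Re b - 1 by rewrite cReD cReN.
have ib : complex.Im (b - 1) = complex.Im b by rewrite cImD cImN oppr0 addr0.
apply: complexP; rewrite ?cReM ?cImM /= rb ib -?eC -?eS; ring.
Qed.

(** Signed powers are stable under integration: the exponent and the power of
    the sign both go up by one. *)
Lemma cintegral_signed_cpower b e x : 0 < complex.Re b -> -1 <= x <= 1 ->
  cintegrable mu `[-1, x] (signed_cpower (b - 1) e) /\
  cintegral mu `[-1, x] (signed_cpower (b - 1) e) =
    (signed_cpower b e.+1 x - (-1) ^+ e.+1) / b.
Proof.
move=> b0 x11; have /andP[_ x1] := x11.
have rb : complex.Re (b - 1) = complex.Re b - 1 by rewrite cReD cReN.
have ib : complex.Im (b - 1) = complex.Im b by rewrite cImD cImN oppr0 addr0.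
have ip (g : R -> R) : measurable_fun setT g ->
    (forall t, `|g t| <= t `^ (complex.Re b - 1)) ->
    mu.-integrable `[-1, 1] (EFin \o (fun t : R => g `|t|)).
  move=> mg gp; apply: (le_integrable _ _ _ (integrable_norm_powR b0)) => //.
    apply/measurable_EFinP; apply: measurable_funTS.
    exact: (measurableT_comp mg (@normr_measurable R setT)).
  by move=> t _; rewrite /= lee_fin [leRHS]ger0_norm ?powR_ge0.
have iC := ip _ (measurable_pcos _ (complex.Im b)) (normr_pcos_le _ (complex.Im b)).
have iS := ip _ (measurable_psin _ (complex.Im b)) (normr_psin_le _ (complex.Im b)).
have [jC eC] := Rintegral_signed e x11 (measurable_pcos _ _) iC.
have [jS eS] := Rintegral_signed e x11 (measurable_psin _ _) iS.
have sub (f : R -> R) : mu.-integrable `[-1, 1] (EFin \o f) ->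
    mu.-integrable `[-1, x] (EFin \o f).
  by move=> i; apply: (integrableS _ _ _ i) => //; apply: subset_itvl; rewrite bnd_simp.
have re t : complex.Re (signed_cpower (b - 1) e t) =
    Num.sg t ^+ e * pcos (complex.Re b - 1) (complex.Im b) `|t|.
  by rewrite /signed_cpower cReM /= mul0r subr0 rb ib.
have im t : complex.Im (signed_cpower (b - 1) e t) =
    Num.sg t ^+ e * psin (complex.Re b - 1) (complex.Im b) `|t|.
  by rewrite /signed_cpower cImM /= mul0r addr0 rb ib.
split; first split.
- have := sub _ jC.
  by apply: eq_integrable => // t _; exact: (congr1 EFin (esym (re t))).
- have := sub _ jS.
  by apply: eq_integrable => // t _; exact: (congr1 EFin (esym (im t))).
have bn0 : b != 0 by apply: contraTneq b0 => ->; rewrite ltxx.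
have I y : 0 <= y <= 1 -> cintegral mu `[0, y] (cpower (b - 1)) = cpower b y / b.
  by move=> y01; rewrite -(cintegral_cpower b0 y01) mulrAC mulfV ?mul1r.
have x01 : 0 <= `|x| <= 1 by rewrite normr_ge0 ler_norml.
transitivity ((Num.sg x ^+ e.+1)%:C%C * cintegral mu `[0, `|x|] (cpower (b - 1)) -
   ((-1) ^+ e.+1)%:C%C * cintegral mu `[0, 1] (cpower (b - 1))).
  apply: complexP; rewrite ?cReD ?cImD ?cReN ?cImN ?cReM ?cImM /= !mul0r ?subr0 ?addr0.
    by rewrite rb ib -eC; apply: eq_Rintegral => t _; rewrite mul0r subr0.
  by rewrite rb ib -eS; apply: eq_Rintegral => t _; rewrite mul0r addr0.
rewrite !I ?ler01 ?lexx//.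
rewrite cpower1 real_complex_sign /signed_cpower; ring.
Qed.

(** A point is negligible. This absorbs the conventions for the value of the
    powers at the origin, which differ between cpowR and signed_cpower. *)
Lemma integrable_off0 (D : set R) (f g : R -> R) : measurable D ->
  (forall t, t != 0 -> f t = g t) -> mu.-integrable D (EFin \o g) ->
  mu.-integrable D (EFin \o f) /\ \int[mu]_(t in D) f t = \int[mu]_(t in D) g t.
Proof.
move=> mD fg ig.
have mg : measurable_fun D g by have /integrableP[/measurable_EFinP] := ig.
have -> : f = fun t => if t == 0 then f 0 else g t.
  by apply/funext => t; case: eqVneq => [->//|/fg].
set f' := fun t => _.
have mf : measurable_fun D f'.
  apply: measurable_fun_if => //.
    by apply: measurable_fun_eqr.
  by apply: measurable_funS mg => //; exact: subIsetl.
have f'g : {in D `\` [set 0], f' =1 g}.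
  move=> t; rewrite inE => -[_ /= t0]; rewrite /f' ifF//.
  by apply/negbTE/eqP.
have m0 : mu [set 0] = 0%E by exact: lebesgue_measure_set1.
have if' : mu.-integrable D (EFin \o f').
  apply: (@negligible_integrable _ _ _ mu D [set 0 : R] (EFin \o f') _ _ _ m0).2 => //.
    exact/measurable_EFinP.
  apply: (@eq_integrable _ _ _ mu _ _ (EFin \o g)).
  - exact: measurableD.
  - by move=> t tD; rewrite /= f'g.
  - by apply: integrableS ig => //; exact: measurableD.
split=> //; rewrite /Rintegral; congr fine.
rewrite (@negligible_integral _ _ _ mu D [set 0 : R])//.
rewrite [RHS](@negligible_integral _ _ _ mu D [set 0 : R])//.
by apply: eq_integral => t tD; rewrite f'g.
Qed.

Lemma cintegral_off0 (D : set R) (f g : R -> R[i]) : measurable D ->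
  (forall t, t != 0 -> f t = g t) -> cintegrable mu D g ->
  cintegrable mu D f /\ cintegral mu D f = cintegral mu D g.
Proof.
move=> mD fg [rg jg].
have [|rf ef] := integrable_off0 (f := fun t => complex.Re (f t)) mD _ rg.
  by move=> t t0 /=; rewrite fg.
have [|jf hf] := integrable_off0 (f := fun t => complex.Im (f t)) mD _ jg.
  by move=> t t0 /=; rewrite fg.
by split=> //; apply: complexP.
Qed.

End signed_powers.

(** * Integration on R^n by peeling off a coordinate *)

Section fubini_consRn.
Context {R : realType}.
Notation mu := (@lebesgue_measure R).
Notation nu := (@lebesgue_measure_Rn R).

Lemma ge0_integral_consRn n (f : Rn R n.+1 -> \bar R) :
  measurable_fun setT f -> (forall t, 0 <= f t)%E ->
  (\int[nu n.+1]_t f t = \int[mu]_y \int[nu n]_t f (consRn (y, t)))%E.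
Proof.
move=> mf f0.
transitivity (\int[pushforward (mu \x nu n) (@consRn R n)]_t f t)%E; first by [].
rewrite ge0_integral_pushforward//; last exact: measurable_consRn.
rewrite preimage_setT.
rewrite -(@fubini_tonelli1 _ _ _ _ _ mu (nu n) (f \o @consRn R n))//.
- by apply: measurableT_comp => //; exact: measurable_consRn.
- by move=> t; exact: f0.
Qed.

Lemma Rintegral_consRn n (f : Rn R n.+1 -> R) :
  (nu n.+1).-integrable setT (EFin \o f) ->
  (forall y, (nu n).-integrable setT (fun t => (f (consRn (y, t)))%:E)) ->
  \int[nu n.+1]_t f t = \int[mu]_y \int[nu n]_t f (consRn (y, t)).
Proof.
move=> intf inty; have /integrableP[mf foo] := intf.
have mcons := @measurable_consRn R n.
have ifc : (mu \x nu n)%E.-integrable setT ((EFin \o f) \o @consRn R n).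
  apply/integrableP; split; first exact: measurableT_comp.
  move: foo; rewrite ge0_integral_consRn//; last exact: measurableT_comp.
  rewrite (@fubini_tonelli1 _ _ _ _ _ mu (nu n) (fun x => `|((EFin \o f) \o @consRn R n) x|%E))//.
  apply: measurableT_comp => //; exact: measurableT_comp.
rewrite /Rintegral; congr fine.
transitivity (\int[pushforward (mu \x nu n) (@consRn R n)]_t (f t)%:E)%E; first by [].
rewrite integral_pushforward//.
rewrite preimage_setT -integral12_prod_meas1//.
apply: eq_integral => y _; rewrite /fubini_F fineK//.
exact: (integrable_fin_num _ (inty y)).
Qed.

Lemma Rintegral_consRn_in n (D : set (Rn R n.+1)) (A : set R) (B : R -> set (Rn R n))
    (f : Rn R n.+1 -> R) :
  measurable D -> measurable A -> (forall y, measurable (B y)) ->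
  (forall y t, D (consRn (y, t)) <-> A y /\ B y t) ->
  (nu n.+1).-integrable D (EFin \o f) ->
  (forall y, A y -> (nu n).-integrable (B y) (fun t => (f (consRn (y, t)))%:E)) ->
  \int[nu n.+1]_(t in D) f t =
  \int[mu]_(y in A) \int[nu n]_(t in B y) f (consRn (y, t)).
Proof.
move=> mD mA mB DAB intf inty.
have fD y t : (f \_ D) (consRn (y, t)) =
    if y \in A then ((fun t => f (consRn (y, t))) \_ (B y)) t else 0.
  rewrite !patchE; case: ifPn => [/set_mem/DAB[/mem_set -> /mem_set ->]//|ND].
  case: ifPn => // /set_mem Ay; case: ifPn => // /set_mem By.
  by move: ND; rewrite mem_set//; apply/DAB.
rewrite Rintegral_mkcond Rintegral_consRn.
- rewrite [RHS]Rintegral_mkcond; apply: eq_Rintegral => y _.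
  rewrite patchE; under eq_Rintegral do rewrite fD.
  case: ifPn => Ay; first by rewrite [RHS]Rintegral_mkcond.
  by rewrite /Rintegral integral0.
- by rewrite -restrict_EFin; apply/integrable_restrict => //; rewrite setTI.
- move=> y; have [Ay|Ay] := boolP (y \in A); last first.
    apply: (eq_integrable _ (cst 0%E)) => //; last exact: integrable0.
    by move=> t _; rewrite /= fD (negPf Ay).
  have : (nu n).-integrable setT (EFin \o ((fun t => f (consRn (y, t))) \_ (B y))).
    rewrite -restrict_EFin; apply/integrable_restrict => //; rewrite setTI.
    by apply: inty; exact: set_mem.
  by apply: eq_integrable => // t _; rewrite /= fD Ay.
Qed.

Lemma cintegral_consRn n (D : set (Rn R n.+1)) (A : set R) (B : R -> set (Rn R n))
    (f : Rn R n.+1 -> R[i]) :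
  measurable D -> measurable A -> (forall y, measurable (B y)) ->
  (forall y t, D (consRn (y, t)) <-> A y /\ B y t) ->
  cintegrable (nu n.+1) D f ->
  (forall y, A y -> cintegrable (nu n) (B y) (fun t => f (consRn (y, t)))) ->
  cintegral (nu n.+1) D f =
  cintegral mu A (fun y => cintegral (nu n) (B y) (fun t => f (consRn (y, t)))).
Proof.
move=> mD mA mB DAB [rf jf] iy; apply: complexP => /=.
  by rewrite (Rintegral_consRn_in mD mA mB)// => y Ay; have [] := iy _ Ay.
by rewrite (Rintegral_consRn_in mD mA mB)// => y Ay; have [] := iy _ Ay.
Qed.

Lemma tnth_consRn0 n y (t : Rn R n) : tnth (consRn (y, t)) ord0 = y.
Proof. by []. Qed.

Lemma tnth_consRn n y (t : Rn R n) i : tnth (consRn (y, t)) (lift ord0 i) = tnth t i.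
Proof. by rewrite !(tnth_nth y). Qed.

Lemma consRn_surj n (l : Rn R n.+1) : exists y t, l = consRn (y, t).
Proof.
exists (thead l), [tuple of behead l]; rewrite [LHS]tuple_eta.
exact: val_inj.
Qed.

(** R^0 is a point of mass one. *)
Lemma integral_Rn0 (f : Rn R 0 -> R) D : measurable D -> D [tuple] ->
  (nu 0).-integrable D (EFin \o f) /\ \int[nu 0]_(t in D) f t = f [tuple].
Proof.
move=> mD D0.
have -> : D = setT by rewrite -subTset => t _; rewrite (tuple0 t).
have -> : f = cst (f [tuple]) by apply/funext => t; rewrite (tuple0 t).
have e0 (c : \bar R) : (\int[nu 0]_(t in setT) (cst c) t = c)%E.
  transitivity (\int[\d_([tuple] : Rn R 0)]_(t in setT) (cst c) t)%E; first by [].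
  by rewrite integral_dirac// diracT mul1e.
split; last by rewrite /Rintegral (e0 (f [tuple])%:E).
apply/integrableP; split; first by apply/measurable_EFinP.
by rewrite (e0 `|(f [tuple])%:E|%E) ltry.
Qed.

Lemma prod_consRn (S : pzSemiRingType) n (F : 'I_n.+1 -> R -> S) y (t : Rn R n) :
  \prod_(i < n.+1) F i (tnth (consRn (y, t)) i) =
  F ord0 y * \prod_(i < n) F (lift ord0 i) (tnth t i).
Proof.
by rewrite big_ord_recl; congr (_ * _); apply: eq_bigr => i _; rewrite tnth_consRn.
Qed.

Lemma integrable_prod_Rn (w : R -> R) n : (forall t, 0 <= w t) ->
  mu.-integrable setT (EFin \o w) ->
  (nu n).-integrable setT (EFin \o (fun l : Rn R n => \prod_(i < n) w (tnth l i))).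
Proof.
move=> w0 iw; have /integrableP[mw woo] := iw.
elim: n => [|n IH]; first by have [] := @integral_Rn0 (fun l => \prod_(i < 0) w (tnth l i)) setT measurableT I.
have mp : measurable_fun setT (fun l : Rn R n.+1 => \prod_(i < n.+1) w (tnth l i)).
  apply: measurable_prod => i _.
  apply: (@measurableT_comp _ _ _ _ _ _ w); first exact/measurable_EFinP.
  exact: measurable_tnth.
have p0 m (l : Rn R m) : 0 <= \prod_(i < m) w (tnth l i) by apply: prodr_ge0.
apply/integrableP; split; first exact/measurable_EFinP.
rewrite ge0_integral_consRn//; last by apply: measurableT_comp => //; exact/measurable_EFinP.
have -> : (\int[mu]_y \int[nu n]_t `|(EFin \o (fun l : Rn R n.+1 => (\prod_(i < n.+1) w (tnth l i))%R)) (consRn (y, t))| =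
    \int[mu]_y ((w y)%:E * \int[nu n]_t ((\prod_(i < n) w (tnth t i))%R)%:E))%E.
  apply: eq_integral => y _; rewrite -ge0_integralZl//.
  - apply: eq_integral => t _.
    rewrite /= (prod_consRn (fun=> w)) ger0_norm// mulr_ge0// p0.
  - by have /integrableP[] := IH.
  - by move=> t _; rewrite lee_fin p0.
  - by rewrite lee_fin.
rewrite ge0_integralZr//; last 2 first.
- by move=> t _; rewrite lee_fin.
- by apply: integral_ge0 => t _; rewrite lee_fin ?p0.
apply: lte_mul_pinfty.
- by apply: integral_ge0 => t _; rewrite lee_fin ?p0.
- have := integrable_fin_num measurableT iw; by [].
- have /integrableP[_] := IH; congr (_ < _)%E; apply: eq_integral => t _.
  by rewrite /= ger0_norm// p0.
Qed.

End fubini_consRn.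

(** * The integral of a product of powers over a chain *)

Section region.
Context {R : realType}.

(** Delta with an arbitrary upper bound, as needed to peel off coordinates. *)
Definition region n (x : R) : set (Rn R n) :=
  [set l : Rn R n | path >=%R x (rcons l (- 1 : R))].

Lemma region_consRn n x y (t : Rn R n) :
  region x (consRn (y, t)) <-> y <= x /\ region y t.
Proof. by split => [/andP[]//|[? ?]]; apply/andP. Qed.

Lemma region_geN1 n x (t : Rn R n) : region x t -> -1 <= x.
Proof.
elim: n x t => [|n IH] x t; first by rewrite (tuple0 t) /region /= andbT.
have [y [u ->]] := consRn_surj t.
by move=> /region_consRn[yx /IH]; move/le_trans; exact.
Qed.

Lemma region_tnth n x (t : Rn R n) i : region x t -> -1 <= tnth t i <= x.
Proof.
elim: n x t i => [|n IH] x t i; first by case: i.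
have [y [u ->]] := consRn_surj t.
move=> /region_consRn[yx yu]; have [j ->|->] := unliftP ord0 i.
  rewrite tnth_consRn; have /andP[-> /=] := IH _ _ j yu.
  by move/le_trans; exact.
by rewrite tnth_consRn0 yx (region_geN1 yu).
Qed.

(** The bound must be allowed to vary with w, since in the induction the head of
    the tuple becomes the new bound. *)
Lemma measurable_region_comp d (T : measurableType d) n (g : T -> R) (u : T -> Rn R n) :
  measurable_fun setT g -> measurable_fun setT u ->
  measurable [set w | region (g w) (u w)].
Proof.
elim: n g u => [|n IH] g u mg mu.
  have -> : [set w | region (g w) (u w)] = [set w | -1 <= g w].
    by apply/seteqP; split => w; rewrite /= (tuple0 (u w)) /region /= andbT.
  rewrite -[X in measurable X]setTI.
  exact: (measurable_fun_ler (@measurable_cst _ _ _ _ setT (-1 : R)) mg measurableT (Y := [set true])).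
have mh : measurable_fun setT (fun w => thead (u w)).
  apply: (measurableT_comp (measurable_tnth (ord0 : 'I_n.+1)) mu).
have mb : measurable_fun setT (fun w => [tuple of behead (u w)] : Rn R n).
  exact: (measurableT_comp (@measurable_behead _ _ n) mu).
have -> : [set w | region (g w) (u w)] =
    [set w | thead (u w) <= g w] `&` [set w | region (thead (u w)) [tuple of behead (u w)]].
  apply/seteqP; split => w /=.
    have [y [t ->]] := consRn_surj (u w).
    by rewrite (_ : [tuple of behead (consRn (y, t))] = t) ?theadE;
      [move/region_consRn | exact: val_inj].
  have [y [t ->]] := consRn_surj (u w).
  by rewrite (_ : [tuple of behead (consRn (y, t))] = t) ?theadE;
      [move/region_consRn | exact: val_inj].
apply: measurableI; last exact: IH.
rewrite -[X in measurable X]setTI.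
exact: (measurable_fun_ler mh mg measurableT (Y := [set true])).
Qed.

Lemma measurable_region n x : measurable (@region n x).
Proof.
exact: (measurable_region_comp (@measurable_cst _ _ _ _ setT (x : R)) (@measurable_id _ _ setT)).
Qed.

End region.
Section iterated.
Context {R : realType} (s : R[i]).
Hypothesis hs : -1 < complex.Re s.
Notation mu := (@lebesgue_measure R).
Notation nu := (@lebesgue_measure_Rn R).

Definition monomial k (t : R) : R[i] := cpowR `|t| s * (t ^+ k)%:C%C.

(** Dominates all the monomials below, and vanishes outside [-1, 1] so that it is
    integrable on the line. *)
Definition envelope (t : R) : R := ((fun t : R => `|t| `^ complex.Re s) \_ `[-1, 1]) t.

Lemma envelope_ge0 t : 0 <= envelope t.
Proof. by rewrite /envelope patchE; case: ifP => // _; exact: powR_ge0. Qed.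

Lemma integrable_envelope : mu.-integrable setT (EFin \o envelope).
Proof.
rewrite -restrict_EFin; apply/integrable_restrict => //; rewrite setTI.
have := @integrable_norm_powR R (complex.Re s + 1); rewrite addrK; apply.
by rewrite -ltrBlDr sub0r.
Qed.

Definition cmeasurable d (T : measurableType d) (f : T -> R[i]) :=
  measurable_fun setT (fun x => complex.Re (f x)) /\
  measurable_fun setT (fun x => complex.Im (f x)).

Lemma cmeasurableM d (T : measurableType d) (f g : T -> R[i]) :
  cmeasurable f -> cmeasurable g -> cmeasurable (fun x => f x * g x).
Proof.
move=> [rf jf] [rg jg]; split.
  under eq_fun do rewrite cReM.
  by apply: measurable_funB; exact: measurable_funM.
under eq_fun do rewrite cImM.
by apply: measurable_funD; exact: measurable_funM.
Qed.

Lemma cmeasurable_prod d (T : measurableType d) I (r : seq I) (f : I -> T -> R[i]) :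
  (forall i, cmeasurable (f i)) -> cmeasurable (fun x => \prod_(i <- r) f i x).
Proof.
move=> mf; elim: r => [|i r IH].
  by split; under eq_fun do rewrite big_nil; exact: measurable_cst.
by under eq_fun do rewrite big_cons; exact: cmeasurableM.
Qed.

Lemma cmeasurable_monomial k : cmeasurable (monomial k).
Proof.
apply: cmeasurableM; last first.
  by split => /=; [exact: measurable_funX|exact: measurable_cst].
have mn := @normr_measurable R setT.
have mc b : cmeasurable (fun t : R => cpower b `|t|).
  split; [exact: (measurableT_comp (measurable_pcos _ _) mn)
         |exact: (measurableT_comp (measurable_psin _ _) mn)].
have -> : (fun t : R => cpowR `|t| s) =
    fun t => if t == 0 then cpowR 0 s else cpower s `|t|.
  apply/funext => t; case: eqVneq => [->|t0]; first by rewrite normr0.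
  by rewrite cpowR_cpower// normr_gt0.
have [m1 m2] := mc s.
have meq : measurable_fun setT (fun t : R => t == 0) by exact: measurable_fun_eqr.
split.
  rewrite (_ : (fun _ => _) = fun t : R => if t == 0 then complex.Re (cpowR 0 s) else complex.Re (cpower s `|t|)).
    by apply: measurable_fun_ifT.
  by apply/funext => t; case: ifP.
rewrite (_ : (fun _ => _) = fun t : R => if t == 0 then complex.Im (cpowR 0 s) else complex.Im (cpower s `|t|)).
  by apply: measurable_fun_ifT.
by apply/funext => t; case: ifP.
Qed.

Lemma normc_cpower (b : R[i]) (t : R) : 0 <= t -> Normc.normc (cpower b t) = t `^ complex.Re b.
Proof.
move=> t0; rewrite /cpower /pcos /psin /= !exprMn -mulrDr cos2Dsin2 mulr1.
by rewrite sqrtr_sqr ger0_norm ?powR_ge0.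
Qed.

Lemma normc_real (a : R) : Normc.normc a%:C%C = `|a|.
Proof. by rewrite /= expr0n /= addr0 sqrtr_sqr. Qed.

Lemma normc_monomial_le k t : -1 <= t <= 1 -> Normc.normc (monomial k t) <= envelope t.
Proof.
move=> t11; rewrite /monomial Normc.normcM normc_real /envelope patchE.
rewrite ifT; last by rewrite inE/= in_itv.
have t1 : `|t ^+ k| <= 1 by rewrite normrX exprn_ile1// ler_norml.
have [->|t0] := eqVneq t 0; last first.
  by rewrite cpowR_cpower ?normr_gt0// normc_cpower// ler_piMr ?powR_ge0.
rewrite normr0 /cpowR eqxx; have [->|s0] := eqVneq s 0.
  by rewrite powRr0 -[X in Normc.normc X]/(1%:C%C) normc_real normr1 mul1r normrX exprn_ile1 ?normr0.
by rewrite -[X in Normc.normc X]/(0%:C%C) normc_real normr0 mul0r powR_ge0.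
Qed.

Lemma normc_prod I (r : seq I) (F : I -> R[i]) :
  Normc.normc (\prod_(i <- r) F i) = \prod_(i <- r) Normc.normc (F i).
Proof.
elim: r => [|i r IH]; first by rewrite !big_nil Normc.normc1.
by rewrite !big_cons Normc.normcM IH.
Qed.

Lemma Re_le_normc (z : R[i]) : `|complex.Re z| <= Normc.normc z.
Proof.
by case: z => a b /=; rewrite -(sqrtr_sqr a) ler_wsqrtr// lerDl sqr_ge0.
Qed.

Lemma Im_le_normc (z : R[i]) : `|complex.Im z| <= Normc.normc z.
Proof.
by case: z => a b /=; rewrite -(sqrtr_sqr b) ler_wsqrtr// lerDr sqr_ge0.
Qed.

(** The coordinates decrease whereas the letters of a chain are listed by
    increasing variable: the exponent of index 0 goes to the last coordinate. *)
Definition integrand n (h : nat -> nat) (l : Rn R n) : R[i] :=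
  \prod_(i < n) monomial (h (n - i.+1)%N) (tnth l i).

Lemma integrand_consRn n h y (t : Rn R n) :
  integrand h (consRn (y, t)) = monomial (h n) y * integrand h t.
Proof.
rewrite /integrand (prod_consRn (fun i : 'I_n.+1 => monomial (h (n.+1 - i.+1)%N))).
by rewrite /= subn1 /=.
Qed.

(** On the region all coordinates lie in [-1, 1], so the integrand is dominated
    by a product of integrable functions of one variable. *)
Lemma cintegrable_integrand n h x : x <= 1 ->
  cintegrable (nu n) (region x) (integrand h : Rn R n -> R[i]).
Proof.
move=> x1.
have [mr mi] : cmeasurable (integrand h : Rn R n -> R[i]).
  apply: cmeasurable_prod => i.
  have [m1 m2] := cmeasurable_monomial (h (n - i.+1)%N).
  by split; [exact: (measurableT_comp m1 (measurable_tnth i))|exact: (measurableT_comp m2 (measurable_tnth i))].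
have iB : (nu n).-integrable (region x) (EFin \o (fun l : Rn R n => \prod_(i < n) envelope (tnth l i))).
  apply: (integrableS measurableT); [exact: measurable_region|by []|].
  exact: (integrable_prod_Rn n envelope_ge0 integrable_envelope).
have le l : region x l -> Normc.normc (integrand h l) <= \prod_(i < n) envelope (tnth l i).
  move=> xl; rewrite normc_prod; apply: ler_prod => i _.
  rewrite (le_trans (normr_ge0 _) (Re_le_normc _)) normc_monomial_le//.
  by have /andP[-> /le_trans] := region_tnth i xl; exact.
have w0 (l : Rn R n) : 0 <= \prod_(i < n) envelope (tnth l i).
  by apply: prodr_ge0 => i _; exact: envelope_ge0.
split; apply: (le_integrable (measurable_region x) _ _ iB).
- by apply/measurable_EFinP; exact: measurable_funTS.
- move=> l xl; rewrite /= lee_fin [leRHS]ger0_norm//.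
  exact: le_trans (Re_le_normc _) (le l xl).
- by apply/measurable_EFinP; exact: measurable_funTS.
- move=> l xl; rewrite /= lee_fin [leRHS]ger0_norm//.
  exact: le_trans (Im_le_normc _) (le l xl).
Qed.

Variable h : nat -> nat.

Definition chain_exponent k : R[i] := s + (h k)%:R + 1.

Definition chain_type k : R[i] * bool := (chain_exponent k, odd (h k)).

Local Notation b := chain_exponent.

(** The chain integral with upper bound x instead of 1, as a combination of signed
    powers of x. *)
Definition chain_upto n x : R[i] :=
  \sum_(0 <= k < n.+1) parity chain_type k * neg_coef b 0 k * pos_coef b k n *
    signed_cpower (psum b k n) (\sum_(k <= m < n) (h m).+1)%N x.

Lemma Re_psum_gt0 k n : (k < n)%N -> 0 < complex.Re (psum b k n).
Proof.
apply: (P_psum (P := fun z : R[i] => 0 < complex.Re z)) => [z w|m].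
  by rewrite cReD; exact: addr_gt0.
rewrite /chain_exponent !cReD /= -(rmorph_nat (real_complex R)) /= -addrA addrC.
rewrite -ltrBlDl sub0r.
by apply: le_lt_trans hs; rewrite lerN2 lerDr ler0n.
Qed.

Lemma psum_neq0 k n : (k < n)%N -> psum b k n != 0.
Proof. by move=> /Re_psum_gt0; apply: contraTneq => ->; rewrite ltxx. Qed.

Lemma pos_coefnn n : pos_coef b n n = 1.
Proof. by rewrite /pos_coef big_geq. Qed.

Lemma pos_coef_recr k n : (k <= n)%N -> pos_coef b k n.+1 = pos_coef b k n / psum b k n.+1.
Proof. by move=> kn; rewrite /pos_coef big_nat_recr. Qed.

(** Each letter of index between k and n contributes (-1)^(h m + 1), the value at
    -1 of the sign of its primitive, against (-1)^(h m) in the parity of n. *)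
Lemma parity_sign k n : (k <= n)%N ->
  parity chain_type k * (-1) ^+ (\sum_(k <= m < n) (h m).+1)%N =
  parity chain_type n * (-1) ^+ (n - k).
Proof.
move=> kn; rewrite /parity.
have sgn_odd m p : (-1) ^+ (\sum_(m <= i < p) odd (h i))%N =
    (-1) ^+ (\sum_(m <= i < p) h i)%N :> R[i].
  rewrite -!prodrXr; apply: eq_bigr => i _; exact: signr_odd.
rewrite !sgn_odd.
have -> : (\sum_(k <= m < n) (h m).+1 = \sum_(k <= m < n) h m + (n - k))%N.
  under eq_bigr do rewrite -addn1.
  by rewrite big_split /= sum_nat_const_nat muln1.
by rewrite -exprD addnA -big_cat_nat//= exprD.
Qed.

(** Each of the n + 1 signed powers of chain_upto n gives one of chain_upto n.+1
    and a constant, minus its value at -1. By cut_sum_alt the constants add up to the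
    missing term k = n.+1. *)
Lemma cintegral_step n x : -1 <= x <= 1 ->
  cintegral mu `[-1, x] (fun y => monomial (h n) y * chain_upto n y) =
  chain_upto n.+1 x.
Proof.
move=> x11.
pose q k : R[i] := parity chain_type k * neg_coef b 0 k * pos_coef b k n.
pose e k p := (\sum_(k <= m < p) (h m).+1)%N.
pose g k y := q k * (monomial (h n) y * signed_cpower (psum b k n) (e k n) y).
have mD : measurable [set` `[-1, x]] by exact: measurable_itv.
have gP k : (k <= n)%N -> cintegrable mu `[-1, x] (g k) /\
    cintegral mu `[-1, x] (g k) = q k * ((signed_cpower (psum b k n.+1) (e k n.+1) x - (-1) ^+ e k n.+1) / psum b k n.+1).
  move=> kn.
  have ek : (e k n.+1 = (h n + e k n).+1)%N by rewrite /e big_nat_recr//= addnS addnC.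
  have bk : s + (h n)%:R + psum b k n = psum b k n.+1 - 1.
    rewrite /psum big_nat_recr//= /chain_exponent; ring.
  have [i1 e1] := cintegral_signed_cpower (h n + e k n) (Re_psum_gt0 (kn : k < n.+1)%N) x11.
  have [|i2 e2] := cintegral_off0 (f := fun y => monomial (h n) y * signed_cpower (psum b k n) (e k n) y) mD _ i1.
    by move=> t t0; rewrite /monomial mul_cpowR_exp// signed_cpowerM// bk.
  split; first exact: cintegrableZ.
  by rewrite cintegralZ// e2 e1 ek.
transitivity (cintegral mu `[-1, x] (fun y => \sum_(k < n.+1) g k y)).
  apply: eq_cintegral => y _; rewrite /chain_upto big_mkord mulr_sumr.
  by apply: eq_bigr => k _; rewrite /g /q; ring.
rewrite cintegral_sum//; last by move=> k; have [] := gP k (ltn_ord k).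
rewrite (eq_bigr (fun k : 'I_n.+1 => q k * ((signed_cpower (psum b k n.+1) (e k n.+1) x - (-1) ^+ e k n.+1) / psum b k n.+1))); last first.
  by move=> k _; have [_ ->] := gP k (ltn_ord k).
rewrite -(big_mkord xpredT (fun k => q k * ((signed_cpower (psum b k n.+1) (e k n.+1) x - (-1) ^+ e k n.+1) / psum b k n.+1))).
have -> : chain_upto n.+1 x =
  \sum_(0 <= k < n.+1) q k * (signed_cpower (psum b k n.+1) (e k n.+1) x / psum b k n.+1)
  + parity chain_type n.+1 * neg_coef b 0 n.+1.
  rewrite /chain_upto big_nat_recr//=; congr (_ + _).
    apply: eq_big_nat => k /andP[_ kn].
    by rewrite /q pos_coef_recr//; ring.
  rewrite pos_coefnn mulr1.
  rewrite /signed_cpower psum0 big_geq// expr0 mul1r.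
  have -> : cpower 0 `|x| = 1 by rewrite -[0]/(0%:R) cpower_nat.
  by rewrite mulr1.
(* The constants: the term k of the alternating sum, up to a common sign. *)
have alt := cut_sum_alt psum_neq0 (ltn0Sn n).
move: alt; rewrite /cut_sum big_nat_recr//= pos_coefnn mulr1.
move=> /eqP; rewrite addr_eq0 => /eqP alt.
rewrite (eq_big_nat _ _ (F2 := fun k => q k * (signed_cpower (psum b k n.+1) (e k n.+1) x / psum b k n.+1)
  - parity chain_type n.+1 * (-1) ^+ n.+1 * ((-1) ^+ k * neg_coef b 0 k * pos_coef b k n.+1))); last first.
  move=> k /andP[_ kn]; rewrite mulrBl mulrBr; congr (_ - _).
  have := parity_sign (ltnW kn); rewrite -/(e k n.+1).
  have -> : (-1) ^+ (n.+1 - k) = (-1) ^+ n.+1 * (-1) ^+ k :> R[i].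
    by rewrite -exprD -signr_odd -[RHS]signr_odd oddD oddB ?(ltnW kn).
  move=> E; rewrite pos_coef_recr// /q.
  transitivity ((parity chain_type k * (-1) ^+ e k n.+1) *
    (neg_coef b 0 k * (pos_coef b k n / psum b k n.+1))); first by ring.
  by rewrite E; ring.
rewrite big_split /= sumrN -mulr_sumr alt; congr (_ + _).
have : (-1) ^+ n.+1 * (-1) ^+ n.+1 = 1 :> R[i] by rewrite -expr2 sqrr_sign.
set u := (-1) ^+ n.+1 => u1.
transitivity (u * u * (parity chain_type n.+1 * neg_coef b 0 n.+1)); last by rewrite u1 mul1r.
ring.
Qed.

Theorem cintegral_integrand n x : -1 <= x <= 1 ->
  cintegral (nu n) (region x) (integrand h : Rn R n -> R[i]) = chain_upto n x.
Proof.
elim: n x => [|n IH] x x11.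
  have reg0 : region x ([tuple] : Rn R 0) by rewrite /region /= andbT; case/andP: x11.
  rewrite /chain_upto big_nat1 /neg_coef /pos_coef !big_geq// /parity big_geq// expr0 !mul1r.
  have mr := measurable_region x : measurable (region x : set (Rn R 0)).
  rewrite /cintegral.
  have [_ ->] := integral_Rn0 (fun l => complex.Re (integrand h l)) mr reg0.
  have [_ ->] := integral_Rn0 (fun l => complex.Im (integrand h l)) mr reg0.
  rewrite /integrand big_ord0 /signed_cpower psum0 expr0 mul1r.
  by rewrite (_ : cpower 0 `|x| = 1) // -[X in cpower X]/(0%:R) cpower_nat.
have x1 : x <= 1 by case/andP: x11.
rewrite (@cintegral_consRn R n (region x) `[-1, x]%classic (@region R n)).
- rewrite -cintegral_step//; apply: eq_cintegral => y; rewrite inE /= in_itv/= => /andP[y1 yx].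
  have y11 : -1 <= y <= 1 by rewrite y1 (le_trans yx).
  rewrite -IH// -cintegralZ; first by apply: eq_cintegral => t _; rewrite integrand_consRn.
    exact: measurable_region.
  by apply: cintegrable_integrand; case/andP: y11.
- exact: measurable_region.
- exact: measurable_itv.
- by move=> y; exact: measurable_region.
- move=> y t; rewrite /= in_itv/=; split => [/region_consRn[yx ry]|[/andP[_ yx] ry]].
    by rewrite yx (region_geN1 ry).
  exact/region_consRn.
- exact: cintegrable_integrand.
- move=> y; rewrite /= in_itv/= => /andP[y1 yx].
  have iy : cintegrable (nu n) (region y) (fun t => monomial (h n) y * integrand h t).
    by apply: cintegrableZ; [exact: measurable_region|apply: cintegrable_integrand; exact: le_trans yx x1].
  apply: eq_cintegrable iy; first exact: measurable_region.
  by move=> t _; rewrite integrand_consRn.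
Qed.

Corollary cintegral_Delta_integrand n :
  cintegral (nu n) (@Delta R n) (integrand h : Rn R n -> R[i]) = chain chain_type n.
Proof.
rewrite -[@Delta R n]/(region 1) cintegral_integrand; last by rewrite lexx andbT; lra.
rewrite /chain_upto /chain /cut_sum; apply: eq_big_nat => k /andP[_ kn].
rewrite /signed_cpower sgr1 expr1n mul1r normr1.
by rewrite cpower1 mulr1.
Qed.

End iterated.

(** * Assembly *)

(** The Vandermonde determinant of the reversed sequence: reversing makes the
    differences a i - a j for i < j appear without a sign. *)
Lemma vandermonde_expansion (R : comPzRingType) n (a : 'I_n -> R) :
  \prod_(i < n) \prod_(j < n | (i < j)%N) (a i - a j) =
  \sum_(p : 'S_n) (-1) ^+ p * \prod_(i < n) a i ^+ p (rev_ord i).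
Proof.
pose v := \row_i a (rev_ord i).
transitivity (\prod_(i < n) \prod_(j < n | (i < j)%N) (v 0 j - v 0 i)).
  rewrite (reindex_inj rev_ord_inj) /=.
  rewrite (eq_bigr (fun i : 'I_n => \prod_(j < n | (j < i)%N) (v 0 i - v 0 j))) => [|i _].
    by rewrite (exchange_big_dep xpredT).
  rewrite (reindex_inj rev_ord_inj) /=; apply: eq_big => j; last by rewrite !mxE.
  by have := ltn_ord i; have := ltn_ord j; lia.
rewrite -det_Vandermonde -det_tr /determinant; apply: eq_bigr => p _.
congr (_ * _); rewrite (reindex_inj rev_ord_inj) /=; apply: eq_bigr => i _.
by rewrite !mxE rev_ordK.
Qed.

Section final_product.
Context {F : fieldType} (s : F).

Definition monomial_type n (i : 'I_n) : F * bool := (s + i%:R + 1, odd i).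

Lemma prod_signs n :
  \prod_(0 <= i < n | odd i != odd n) (-1) ^+ odd i =
  (if odd n then 1 else (-1) ^+ n./2) :> F.
Proof.
have signs m : \prod_(0 <= i < m) (-1) ^+ odd i = (-1) ^+ m./2 :> F.
  elim: m => [|m IH]; first by rewrite big_geq.
  by rewrite big_nat_recr//= IH -exprD uphalf_half addnC.
case: ifP => on; first by rewrite big1// => i; case: (odd i).
by rewrite -signs big_mkcond; apply: eq_bigr => i _; case: (odd i).
Qed.

(** The signs produced by the recursion are those of the pairs of opposite
    parity in the closed form, so they cancel in the final product. *)
Lemma steps_sign_pairs n :
  \prod_(0 <= i < n) \prod_(0 <= j < n | (i < j)%N && (odd i != odd j)) (-1) ^+ odd i =
  steps_sign n :> F.
Proof.
elim: n => [|n IH]; first by rewrite big_geq.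
rewrite /= -IH -prod_signs big_nat_recr//= [X in _ * X]big1_seq ?mulr1; last first.
  by move=> j; rewrite mem_index_iota; lia.
rewrite [X in _ = X * _]big_mkcond -big_split /=; apply: eq_big_nat => i /andP[_ ilt].
rewrite big_mkcond big_nat_recr//= -big_mkcond /= ilt /= mulrC; congr (_ * _).
Qed.

Lemma closed_form_monomials n :
  steps_sign n * closed_form (@monomial_type n) =
  (\prod_(1 <= i < n.+1)
     \prod_(1 <= j < n.+1 | (i < j)%N && (i == j %[mod 2])%N) (j%:R - i%:R)) /
  ((\prod_(1 <= i < n.+1 | (i == 1 %[mod 2])%N) (s + i%:R)) *
   \prod_(1 <= i < n.+1)
     \prod_(1 <= j < n.+1 | (i < j)%N && (i != j %[mod 2])%N)
       (2 * s + i%:R + j%:R)).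
Proof.
have mod2S i j : (i.+1 == j.+1 %[mod 2])%N = (odd i == odd j).
  by rewrite !modn2 /=; case: (odd i) (odd j) => [] [].
pose D i j := 2 * s + i.+1%:R + j.+1%:R.
have -> : closed_form (@monomial_type n) =
  (\prod_(0 <= i < n | ~~ odd i) (s + i.+1%:R))^-1 *
  \prod_(0 <= i < n) \prod_(0 <= j < n | (i < j)%N)
    (if odd i == odd j then j.+1%:R - i.+1%:R else (-1) ^+ odd i / D i j).
  rewrite /closed_form !big_mkord; congr (_^-1 * _).
    by apply: eq_bigr => i _; rewrite /= -natr1 addrA.
  apply: eq_bigr => i _; rewrite big_mkord; apply: eq_bigr => j _.
  rewrite /pair_factor /=; case: ifP => _; first by rewrite -!natr1; ring.
  by congr (_ / _); rewrite /D -!natr1; ring.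
have -> : \prod_(0 <= i < n) \prod_(0 <= j < n | (i < j)%N)
    (if odd i == odd j then j.+1%:R - i.+1%:R else (-1) ^+ odd i / D i j) =
  (\prod_(0 <= i < n) \prod_(0 <= j < n | (i < j)%N && (odd i == odd j)) (j.+1%:R - i.+1%:R)) *
  (steps_sign n * (\prod_(0 <= i < n) \prod_(0 <= j < n | (i < j)%N && (odd i != odd j)) D i j)^-1).
  rewrite -steps_sign_pairs -prodfV -!big_split /=; apply: eq_bigr => i _.
  rewrite (bigID (fun j => odd i == odd j)) /=; congr (_ * _).
    by apply: eq_bigr => j /andP[_ ->].
  rewrite -prodfV -big_split /=.
  by apply: eq_bigr => j /andP[_ /negPf ->].
have -> : \prod_(1 <= i < n.+1)
     \prod_(1 <= j < n.+1 | (i < j)%N && (i == j %[mod 2])%N) (j%:R - i%:R) =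
  \prod_(0 <= i < n) \prod_(0 <= j < n | (i < j)%N && (odd i == odd j)) (j.+1%:R - i.+1%:R) :> F.
  rewrite big_add1 /=; apply: eq_bigr => i _; rewrite big_add1 /=.
  by apply: eq_bigl => j; rewrite mod2S ltnS.
have -> : \prod_(1 <= i < n.+1) \prod_(1 <= j < n.+1 | (i < j)%N && (i != j %[mod 2])%N)
       (2 * s + i%:R + j%:R) =
  \prod_(0 <= i < n) \prod_(0 <= j < n | (i < j)%N && (odd i != odd j)) D i j.
  rewrite big_add1 /=; apply: eq_bigr => i _; rewrite big_add1 /=.
  by apply: eq_bigl => j; rewrite mod2S ltnS.
have -> : \prod_(1 <= i < n.+1 | (i == 1 %[mod 2])%N) (s + i%:R) =
  \prod_(0 <= i < n | ~~ odd i) (s + i.+1%:R).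
  by rewrite big_add1 /=; apply: eq_bigl => i; rewrite (mod2S i 0); case: (odd i).
have sgn2 : steps_sign n * steps_sign n = 1 :> F.
  elim: (n) => [|m IH]; first by rewrite mulr1.
  rewrite /= mulrACA IH mulr1; case: ifP => _; first by rewrite mulr1.
  by rewrite -expr2 sqrr_sign.
rewrite invfM; set A := \prod_(_ <= _ < _) _; set B := (\prod_(_ <= _ < _ | _) _)^-1.
set E := (\prod_(_ <= _ < _) _)^-1.
transitivity ((steps_sign n * steps_sign n) * (A * (B * E))); first by ring.
by rewrite sgn2 mul1r.
Qed.

End final_product.

Lemma card_odd_ord n : #|[pred i : 'I_n | odd i]| = n./2.
Proof.
rewrite -sum1_card (eq_bigl (fun i : 'I_n => odd i))// big_mkcond /=.
rewrite -(big_mkord xpredT (fun i => if odd i then 1 else 0)%N).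
elim: n => [|n IH]; first by rewrite big_geq.
by rewrite big_nat_recr//= IH uphalf_half addnC; case: (odd n).
Qed.

Section assembly.
Context {R : realType} (s : R[i]).
Hypothesis hs : -1 < complex.Re s.

Definition perm_exponents n (p : 'S_n) (k : nat) : nat :=
  oapp (fun i : 'I_n => val (p i)) 0%N (insub k).

Lemma perm_exponentsE n (p : 'S_n) (i : 'I_n) : perm_exponents p i = p i.
Proof. by rewrite /perm_exponents valK. Qed.

Lemma expand_integrand n (l : Rn R n) :
  (\prod_(i < n) cpowR `|tnth l i| s) *
    \prod_(i < n) \prod_(j < n | (i < j)%N) (tnth l i - tnth l j)%:C%C =
  \sum_(p : 'S_n) (-1) ^+ p * integrand s (perm_exponents p) l.
Proof.
have -> : \prod_(i < n) \prod_(j < n | (i < j)%N) (tnth l i - tnth l j)%:C%C =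
    (\prod_(i < n) \prod_(j < n | (i < j)%N) (tnth l i - tnth l j))%:C%C.
  by rewrite rmorph_prod; apply: eq_bigr => i _; rewrite rmorph_prod.
rewrite vandermonde_expansion rmorph_sum mulr_sumr; apply: eq_bigr => p _.
rewrite rmorphM /= real_complex_sign mulrCA; congr (_ * _).
rewrite rmorph_prod -big_split; apply: eq_bigr => i _ /=.
by rewrite /monomial -[(n - i.+1)%N]/(val (rev_ord i)) perm_exponentsE.
Qed.

Lemma cintegral_expansion n :
  let G := fun l : Rn R n => \sum_(p : 'S_n) (-1) ^+ p * integrand s (perm_exponents p) l in
  cintegrable (lebesgue_measure_Rn n) (@Delta R n) G /\
  cintegral (lebesgue_measure_Rn n) (@Delta R n) G = altchain (@monomial_type _ s n).
Proof.
move=> G; have mD : measurable (@Delta R n) := @measurable_region R n 1.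
have ip p : cintegrable (lebesgue_measure_Rn n) (@Delta R n) (integrand s (perm_exponents p) : Rn R n -> _).
  exact: cintegrable_integrand.
have ipZ (p : 'S_n) : cintegrable (lebesgue_measure_Rn n) (@Delta R n)
    (fun l : Rn R n => (-1) ^+ p * integrand s (perm_exponents p) l).
  exact: cintegrableZ.
split; first exact: cintegrable_sum.
rewrite cintegral_sum//; apply: eq_bigr => p _.
rewrite cintegralZ// cintegral_Delta_integrand//; congr (_ * _).
apply: eq_chain => k kn; rewrite -[k]/(val (Ordinal kn)) extendE /=.
by rewrite /chain_type /chain_exponent -[k]/(val (Ordinal kn)) perm_exponentsE.
Qed.

End assembly.

Theorem theorem8 (R : realType) (n : nat) (hn : (1 <= n)%N)
    (s : R[i]) (hs : -1 < complex.Re s) :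
  let F := fun l : Rn R n =>
    (\prod_(i < n) cpowR `|tnth l i| s) *
    \prod_(i < n) \prod_(j < n | (i < j)%N) (tnth l i - tnth l j)%:C%C in
  cintegrable (lebesgue_measure_Rn n) (@Delta R n) F /\
  cintegral (lebesgue_measure_Rn n) (@Delta R n) F =
    2 ^+ n *
    ((\prod_(1 <= i < n.+1)
        \prod_(1 <= j < n.+1 | (i < j)%N && (i == j %[mod 2])%N)
          (j%:R - i%:R)) /
     ((\prod_(1 <= i < n.+1 | (i == 1 %[mod 2])%N) (s + i%:R)) *
      \prod_(1 <= i < n.+1)
        \prod_(1 <= j < n.+1 | (i < j)%N && (i != j %[mod 2])%N)
          (2 * s + i%:R + j%:R))).
Proof.
move=> F.
have -> : F = fun l => \sum_(p : 'S_n) (-1) ^+ p * integrand s (perm_exponents p) l.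
  by apply/funext => l; exact: expand_integrand.
have [iG ->] := cintegral_expansion hs n.
split=> //; rewrite -closed_form_monomials.
rewrite (@altchain_closed_form _ (fun z : R[i] => 0 < complex.Re z)).
- by rewrite mulrAC mulrA [_ * 2 ^+ n]mulrC -!mulrA.
- by rewrite ltxx.
- by rewrite ltr01.
- by move=> x y; rewrite cReD; exact: addr_gt0.
- move=> i j [/(congr1 (fun z => z - 1 - s))]; rewrite !addrK ![s + _]addrC !addrK.
  by move=> /eqP; rewrite eqr_nat => /eqP/val_inj.
- move=> i; rewrite !cReD /= -(rmorph_nat (real_complex R)) /= -addrA addrC.
  rewrite -ltrBlDl sub0r.
  by apply: le_lt_trans hs; rewrite lerN2 lerDr ler0n.
- exact: card_odd_ord.
Qed.
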